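(* Let $\alpha\in(0,1)$, $T>0$, $\mathcal{A}\in\mathbb{C}^{d\times d}$, $x_0\in\mathbb{C}^d$, $\ell_1,\dots,\ell_d\in\mathbb{C}$, $\delta_1,\dots,\delta_d>0$, and $\vartheta(t)=(\ell_1t^{\delta_1},\dots,\ell_dt^{\delta_d})^\top$. Then $x(t)=\mathcal{E}_\alpha(\mathcal{A}t)x_0+\sum_{j=0}^\infty\mathcal{A}^j\nu_j(t)$, where $$\nu_j(t)=\Big(\ell_k\frac{\prod_{i=2}^{j+2}\Gamma(i-\alpha+\delta_k)}{\Gamma(2-\alpha)^{j+1}\prod_{i=2}^{j+2}\Gamma(i+\delta_k)}t^{j+1+\delta_k}\Big)_{k=1,\dots,d}^\top,$$ satisfies $x(0)=x_0$ and ${}^LD^\alpha x(t)=\mathcal{A}x(t)+\vartheta(t)$ for every $t\in(0,T]$.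
   Context: $\mathcal{E}_\alpha(s)=\sum_{n=0}^\infty\frac{s^n}{\Gamma(2-\alpha)^n\prod_{j=1}^n\frac{\Gamma(j+1)}{\Gamma(j+1-\alpha)}}$ (matrix arguments allowed). Caputo derivative ${}^CD^\alpha x(t)=\frac{1}{\Gamma(1-\alpha)}\int_0^t (t-\tau)^{-\alpha}x'(\tau)d\tau$; L-fractional derivative ${}^LD^\alpha x(t)=\frac{\Gamma(2-\alpha)}{t^{1-\alpha}}{}^CD^\alpha x(t)$ (componentwise). *)

(* Defs.v *)
From Stdlib Require Import Reals.
From Coquelicot Require Import Coquelicot.
Open Scope R_scope.

(* Vectors in C^d: functions nat -> C, only indices k < d are meaningful.
   Matrices in C^{d x d}: functions nat -> nat -> C, only indices < d used. *)
Definition vec := nat -> C.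
Definition mat := nat -> nat -> C.

Fixpoint csum (n : nat) (f : nat -> C) : C :=
  match n with
  | O => RtoC 0
  | S m => Cplus (csum m f) (f m)
  end.

Definition matmul (d : nat) (A B : mat) : mat :=
  fun i j => csum d (fun l => Cmult (A i l) (B l j)).

Definition matvec (d : nat) (A : mat) (v : vec) : vec :=
  fun i => csum d (fun l => Cmult (A i l) (v l)).

Definition matscale (c : C) (A : mat) : mat := fun i j => Cmult c (A i j).

Definition matid : mat := fun i j => if Nat.eqb i j then RtoC 1 else RtoC 0.

Fixpoint matpow (d : nat) (A : mat) (n : nat) : mat :=
  match n with
  | O => matid
  | S m => matmul d A (matpow d A m)
  end.

Definition Gamma (s : R) : R :=
  RInt_gen (fun t => Rpower t (s - 1) * exp (- t)) (at_right 0) (Rbar_locally p_infty).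

(* t^p for t >= 0 and p > 0, with the convention 0^p = 0 *)
Definition powr (t p : R) : R := if Rle_dec t 0 then 0 else Rpower t p.

Fixpoint ML_den (a : R) (n : nat) : R :=
  match n with
  | O => 1
  | S m => ML_den a m * (Gamma (2 - a) * (Gamma (INR (S m) + 1) / Gamma (INR (S m) + 1 - a)))
  end.

Definition is_MittagLeffler (a : R) (d : nat) (M : mat) (E : mat) : Prop :=
  forall i j, (i < d)%nat -> (j < d)%nat ->
    is_series (fun n => Cmult (RtoC (/ ML_den a n)) (matpow d M n i j)) (E i j).

Fixpoint prodR (n : nat) (f : nat -> R) : R :=
  match n with
  | O => 1
  | S m => prodR m f * f m
  end.

Definition nu (a : R) (l : nat -> C) (delta : nat -> R) (j : nat) (t : R) : vec :=
  fun k =>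
    Cmult (l k)
      (RtoC (prodR (S j) (fun i => Gamma (INR (i + 2) - a + delta k))
             / (Gamma (2 - a) ^ (S j) * prodR (S j) (fun i => Gamma (INR (i + 2) + delta k)))
             * powr t (INR (S j) + delta k))).

Definition is_Caputo (a : R) (f : R -> C) (t : R) (v : C) : Prop :=
  exists f' : R -> C,
    (forall s, 0 < s < t -> is_derive f s (f' s)) /\
    exists I : C,
      is_RInt_gen (fun s => Cmult (RtoC (Rpower (t - s) (- a))) (f' s))
        (at_right 0) (at_left t) I /\
      v = Cmult (RtoC (/ Gamma (1 - a))) I.

Definition is_Lfrac (a : R) (f : R -> C) (t : R) (v : C) : Prop :=
  exists c, is_Caputo a f t c /\
    v = Cmult (RtoC (Gamma (2 - a) / Rpower t (1 - a))) c.

(* Main.v *)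
(** The operator is diagonal on powers: for [p >= 1] it sends [t^p] to
    [lambda_p t^(p-1)] with [lambda_p = Gamma(2-a) Gamma(p+1) / Gamma(p+1-a)],
    by Euler's Beta integral. The exponents in [x(t) - x0] are all of the form
    [n + 1] or [n + 1 + delta_k], and the coefficients are, up to the powers of
    [A], reciprocals of products of consecutive [lambda_p], so that applying
    the operator term by term shifts the index by one. Since [lambda_p] tends
    to infinity the series are entire power series times a fixed power of [t];
    the derivative then converges uniformly on [(0, t)], which allows the
    exchange of the sum with the integral against [(t - s)^(-a)]. *)

Require Import Defs.
From Stdlib Require Import Reals Lra Lia.
From Coquelicot Require Import Coquelicot.
Open Scope R_scope.

(** * Improper integrals over an interval *)

(** The integrals cannot be taken over closed intervals: (t - s)^(-a) blows up at t, and [Rpower] is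
    not the power function at 0, where [Rpower 0 p] is 1. Everything is therefore stated on an open
    interval with its two end filters, in a form shared by (0, t) and by the half line on which
    [Gamma] is defined. What is needed about [Gamma] (recursion, positivity, growth of ratios) comes
    from integration by parts and pointwise comparison of integrands; the Beta integral is obtained
    with the same means, without any double integral. The components of the forcing term carry
    different exponents delta_k, so the vector solution is not one power series times one power of
    t. It is cut into scalar series indexed by a row and a column. The entries of A^n then enter
    only as complex numbers bounded by K^n, a factor that cannot spoil an infinite radius of
    convergence. The matrix structure returns at the end, through finite sums. *)

Lemma ball_Rabs (x e y : R) : ball x e y -> Rabs (y - x) < e.
Proof. intros H; exact H. Qed.

(** The common features of (0, t) and (0, +oo): segments with endpoints taken along [Fa] and [Fb]
    eventually lie inside [D] and are correctly oriented, so hypotheses on integrands are only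
    required on [D], never at the ends. *)
Record interval_filters (D : R -> Prop) (Fa Fb : (R -> Prop) -> Prop) : Prop := {
  if_convex : forall x y z, D x -> D z -> x <= y <= z -> D y;
  if_left : Fa D;
  if_right : Fb D;
  if_le : filter_prod Fa Fb (fun ab => fst ab <= snd ab)
}.

Lemma interval_filters_segment (t : R) : 0 < t ->
  interval_filters (fun x => 0 < x < t) (at_right 0) (at_left t).
Proof.
intros Ht.
assert (H1 : at_right 0 (fun x => 0 < x < t / 2)).
{ exists (mkposreal (t / 2) ltac:(lra)). intros y Hy Hy0.
  apply ball_Rabs in Hy; simpl in Hy.
  apply Rabs_def2 in Hy. lra. }
assert (H2 : at_left t (fun x => t / 2 < x < t)).
{ exists (mkposreal (t / 2) ltac:(lra)). intros y Hy Hy0.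
  apply ball_Rabs in Hy; simpl in Hy.
  apply Rabs_def2 in Hy. lra. }
split.
- intros; lra.
- generalize H1; apply filter_imp. intros; lra.
- generalize H2; apply filter_imp. intros; lra.
- exists (fun x => 0 < x < t / 2) (fun x => t / 2 < x < t); auto. simpl; intros; lra.
Qed.

Lemma interval_filters_half_line :
  interval_filters (fun x => 0 < x) (at_right 0) (Rbar_locally p_infty).
Proof.
assert (H1 : at_right 0 (fun x => 0 < x < 1)).
{ exists (mkposreal 1 ltac:(lra)). intros y Hy Hy0.
  apply ball_Rabs in Hy; simpl in Hy.
  apply Rabs_def2 in Hy. lra. }
assert (H2 : Rbar_locally p_infty (fun x => 1 < x)) by (exists 1; auto).
split.
- intros; lra.
- generalize H1; apply filter_imp. intros; lra.
- generalize H2; apply filter_imp. intros; lra.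
- exists (fun x => 0 < x < 1) (fun x => 1 < x); auto. simpl; intros; lra.
Qed.

Section Improper.

Context {D : R -> Prop} {Fa Fb : (R -> Prop) -> Prop}
  {PFa : ProperFilter Fa} {PFb : ProperFilter Fb}
  (HD : interval_filters D Fa Fb).

Lemma filter_prod_segment :
  filter_prod Fa Fb (fun ab => fst ab <= snd ab /\
    forall x, fst ab <= x <= snd ab -> D x).
Proof.
destruct HD as [Hc Ha Hb Hle].
assert (H : filter_prod Fa Fb (fun ab => D (fst ab) /\ D (snd ab))).
{ exists D D; auto. }
generalize (filter_and _ _ Hle H). apply (filter_imp (F := filter_prod Fa Fb)).
intros [u v]; simpl; intros [H1 [H2 H3]]; split; auto.
intros x Hx; apply (Hc u x v); auto.
Qed.

Lemma RInt_gen_abs_le (f g : R -> R) (lf lg : R) :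
  (forall x, D x -> Rabs (f x) <= g x) ->
  is_RInt_gen f Fa Fb lf -> is_RInt_gen g Fa Fb lg -> Rabs lf <= lg.
Proof.
intros H Hf Hg.
apply (RInt_gen_norm (Fa := Fa) (Fb := Fb) (V := R_CompleteNormedModule) f g lf lg); auto.
- generalize filter_prod_segment; apply (filter_imp (F := filter_prod Fa Fb)); tauto.
- generalize filter_prod_segment; apply (filter_imp (F := filter_prod Fa Fb)).
  intros ab [_ Hab] x Hx. apply H, Hab, Hx.
Qed.

Lemma RInt_gen_le (f g : R -> R) (lf lg : R) :
  (forall x, D x -> f x <= g x) ->
  is_RInt_gen f Fa Fb lf -> is_RInt_gen g Fa Fb lg -> lf <= lg.
Proof.
intros H Hf Hg.
generalize (is_RInt_gen_minus (Fa := Fa) (Fb := Fb) _ _ _ _ Hg Hf); intros Hm.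
assert (Hb : Rabs (lg - lf) <= lg - lf).
{ apply (RInt_gen_abs_le (fun x => minus (g x) (f x)) (fun x => minus (g x) (f x))); auto.
  intros x Hx. specialize (H x Hx). unfold minus, plus, opp; simpl.
  rewrite Rabs_right; lra. }
generalize (Rabs_pos (lg - lf)). lra.
Qed.

Lemma is_RInt_gen_ext_on (f g : R -> R) (l : R) :
  (forall x, D x -> f x = g x) -> is_RInt_gen f Fa Fb l -> is_RInt_gen g Fa Fb l.
Proof.
intros H. apply (is_RInt_gen_ext (Fa := Fa) (Fb := Fb)).
generalize filter_prod_segment; apply (filter_imp (F := filter_prod Fa Fb)).
intros ab [Hle Hab] x. rewrite Rmin_left, Rmax_right by auto. intros Hx. apply H, Hab. lra.
Qed.

(** [is_RInt_gen] is a limit of a relation. Continuity on [D] makes the proper integrals exist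
    eventually, which turns it into the limit of a function, to which the Cauchy criterion
    applies. *)
Lemma is_RInt_gen_iff (f : R -> R) (l : R) :
  (forall x, D x -> continuous f x) ->
  is_RInt_gen f Fa Fb l <->
  filterlim (fun ab => RInt f (fst ab) (snd ab)) (filter_prod Fa Fb) (locally l).
Proof.
intros Hc.
assert (Hex : filter_prod Fa Fb (fun ab => ex_RInt f (fst ab) (snd ab))).
{ generalize filter_prod_segment; apply (filter_imp (F := filter_prod Fa Fb)).
  intros ab [Hle Hab]. apply (ex_RInt_continuous (V := R_CompleteNormedModule)).
  rewrite Rmin_left, Rmax_right by auto. intros; apply Hc, Hab; auto. }
split; intros H P HP.
- specialize (H P HP). unfold filtermapi in H. unfold filtermap.
  generalize H; apply (filter_imp (F := filter_prod Fa Fb)). intros ab [y [Hy HPy]].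
  now rewrite (is_RInt_unique _ _ _ _ Hy).
- specialize (H P HP). unfold filtermap in H. unfold filtermapi.
  generalize (filter_and _ _ Hex H); apply (filter_imp (F := filter_prod Fa Fb)).
  intros ab [H1 H2]. exists (RInt f (fst ab) (snd ab)); split; auto.
  now apply (RInt_correct (V := R_CompleteNormedModule)).
Qed.

Lemma is_RInt_gen_antiderivative (F f : R -> R) (la lb : R) :
  (forall x, D x -> is_derive F x (f x)) ->
  (forall x, D x -> continuous f x) ->
  filterlim F Fa (locally la) -> filterlim F Fb (locally lb) ->
  is_RInt_gen f Fa Fb (lb - la).
Proof.
intros Hd Hc Ha Hb.
apply is_RInt_gen_iff; auto.
apply filterlim_ext_loc with (fun ab => minus (F (snd ab)) (F (fst ab))).
- generalize filter_prod_segment; apply (filter_imp (F := filter_prod Fa Fb)).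
  intros ab [Hle Hab]. symmetry. apply is_RInt_unique.
  apply (is_RInt_derive (V := R_CompleteNormedModule)); rewrite Rmin_left, Rmax_right by auto; intros; auto.
- change (lb - la) with (minus lb la). unfold minus.
  eapply filterlim_comp_2.
  + apply filterlim_comp with Fb; [apply filterlim_snd | exact Hb].
  + apply filterlim_comp with (locally la);
    [apply filterlim_comp with Fa; [apply filterlim_fst | exact Ha]|].
    apply (filterlim_opp (V := R_NormedModule)).
  + apply (filterlim_plus (V := R_NormedModule)).
Qed.

(** The bounds [u] and [v] are unordered, hence the absolute value on the right: the Cauchy
    criterion compares two left (or two right) endpoints whose order is unknown. *)
Lemma RInt_abs_le_on (f g : R -> R) (u v : R) :
  (forall x, D x -> continuous f x) -> (forall x, D x -> continuous g x) ->
  (forall x, D x -> Rabs (f x) <= g x) -> D u -> D v ->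
  Rabs (RInt f u v) <= Rabs (RInt g u v).
Proof.
intros Hf Hg Hfg Hu Hv.
assert (Hw : forall u v, u <= v -> D u -> D v -> Rabs (RInt f u v) <= Rabs (RInt g u v)).
{ clear u v Hu Hv. intros u v Huv Hu Hv.
  assert (Hin : forall x, u <= x <= v -> D x) by (intros; apply (if_convex _ _ _ HD u x v); auto).
  apply Rle_trans with (2 := Rle_abs _).
  apply (norm_RInt_le (V := R_NormedModule) f g u v); auto;
  apply (RInt_correct (V := R_CompleteNormedModule));
  apply (ex_RInt_continuous (V := R_CompleteNormedModule));
  rewrite Rmin_left, Rmax_right by auto; intros; auto. }
destruct (Rle_dec u v) as [H|H]; [now apply Hw|].
rewrite <- (opp_RInt_swap f v u), <- (opp_RInt_swap g v u).
- change (Rabs (- RInt f v u) <= Rabs (- RInt g v u)). rewrite !Rabs_Ropp. apply Hw; auto; lra.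
- apply (ex_RInt_continuous (V := R_CompleteNormedModule)).
  rewrite Rmin_left, Rmax_right by lra; intros; apply Hg, (if_convex _ _ _ HD v z u); auto.
- apply (ex_RInt_continuous (V := R_CompleteNormedModule)).
  rewrite Rmin_left, Rmax_right by lra; intros; apply Hf, (if_convex _ _ _ HD v z u); auto.
Qed.

Lemma RInt_Chasles_on (f : R -> R) (u v w : R) :
  (forall x, D x -> continuous f x) -> D u -> D v -> D w ->
  RInt f u v + RInt f v w = RInt f u w.
Proof.
intros Hf Hu Hv Hw.
assert (H : forall u v, D u -> D v -> ex_RInt f u v).
{ intros x y Hx Hy. apply (ex_RInt_continuous (V := R_CompleteNormedModule)). intros z Hz. apply Hf.
  destruct (Rle_dec x y).
  - rewrite Rmin_left, Rmax_right in Hz by lra. apply (if_convex _ _ _ HD x z y); auto.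
  - rewrite Rmin_right, Rmax_left in Hz by lra. apply (if_convex _ _ _ HD y z x); auto. }
apply (RInt_Chasles (V := R_CompleteNormedModule) f u v w); auto.
Qed.

(** Cauchy criterion: the integrals of [f] over two segments differ by a piece between the left
    endpoints and a piece between the right endpoints, and each is dominated by the same piece for
    [g]. *)
Lemma ex_RInt_gen_dominated (f g : R -> R) (lg : R) :
  (forall x, D x -> continuous f x) -> (forall x, D x -> continuous g x) ->
  (forall x, D x -> Rabs (f x) <= g x) ->
  is_RInt_gen g Fa Fb lg -> exists lf, is_RInt_gen f Fa Fb lf.
Proof.
intros Hf Hg Hfg Hl.
apply is_RInt_gen_iff in Hl; auto.
assert (HC : exists y, filterlim (fun ab => RInt f (fst ab) (snd ab)) (filter_prod Fa Fb) (locally y)).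
2:{ destruct HC as [y Hy]; exists y; now apply is_RInt_gen_iff. }
apply (filterlim_locally_cauchy (U := R_CompleteSpace)).
intros eps.
destruct (proj2 (filterlim_locally_cauchy (U := R_CompleteSpace) _)
  (ex_intro _ lg Hl) (pos_div_2 eps)) as [P [HP HPc]].
destruct HP as [Q S HQ HS HQS].
exists (fun ab => (Q (fst ab) /\ D (fst ab)) /\ (S (snd ab) /\ D (snd ab))).
split.
{ exists (fun x => Q x /\ D x) (fun x => S x /\ D x); auto.
  - apply filter_and; auto; apply (if_left _ _ _ HD).
  - apply filter_and; auto; apply (if_right _ _ _ HD). }
intros [u v] [u' v']; simpl; intros [[Hu Du] [Hv Dv]] [[Hu' Du'] [Hv' Dv']].
(* Moving one endpoint at a time isolates the integral of [g] from [u] to [u'] and from [v] to [v'],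
   each below half of [eps]. *)
assert (E1 := HPc (u, v) (u', v) (HQS _ _ Hu Hv) (HQS _ _ Hu' Hv)).
assert (E2 := HPc (u, v) (u, v') (HQS _ _ Hu Hv) (HQS _ _ Hu Hv')).
unfold ball in E1, E2 |- *; simpl in E1, E2 |- *.
unfold AbsRing_ball, abs, minus, plus, opp in E1, E2 |- *; simpl in E1, E2 |- *.
assert (A1 := RInt_abs_le_on f g u u' Hf Hg Hfg Du Du').
assert (A2 := RInt_abs_le_on f g v v' Hf Hg Hfg Dv Dv').
rewrite <- (RInt_Chasles_on g u u' v) in E1 by auto.
rewrite <- (RInt_Chasles_on g u v v') in E2 by auto.
rewrite <- (RInt_Chasles_on f u u' v), <- (RInt_Chasles_on f u' v v') by auto.
replace (RInt g u' v + - (RInt g u u' + RInt g u' v)) with (- RInt g u u') in E1 by lra.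
replace (RInt g u v + RInt g v v' + - RInt g u v) with (RInt g v v') in E2 by lra.
rewrite Rabs_Ropp in E1.
replace (RInt f u' v + RInt f v v' + - (RInt f u u' + RInt f u' v))
  with (RInt f v v' + - RInt f u u') by lra.
apply Rle_lt_trans with (1 := Rabs_triang _ _). rewrite Rabs_Ropp. lra.
Qed.

(** The weight [w] may be unbounded, but it is integrable: the bound [M] on [g] gives existence of
    the integral by domination with M w, and a uniform error [e N] on the other factor changes the
    integral by at most e N * W. *)
Lemma is_RInt_gen_uniform_limit (w g : R -> R) (gN : nat -> R -> R) (e I : nat -> R) (W L M : R) :
  (forall x, D x -> 0 <= w x) -> (forall x, D x -> continuous w x) ->
  (forall x, D x -> continuous g x) -> (forall x, D x -> Rabs (g x) <= M) ->
  is_RInt_gen w Fa Fb W ->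
  (forall N, is_RInt_gen (fun x => w x * gN N x) Fa Fb (I N)) ->
  (forall N x, D x -> Rabs (g x - gN N x) <= e N) ->
  is_lim_seq e 0 -> is_lim_seq I L ->
  is_RInt_gen (fun x => w x * g x) Fa Fb L.
Proof.
intros Hw Hwc Hgc HM HW HI He He0 HIL.
assert (Hex : exists l, is_RInt_gen (fun x => w x * g x) Fa Fb l).
{ apply (ex_RInt_gen_dominated _ (fun x => scal M (w x)) (scal M W)).
  - intros x Hx. apply (continuous_mult (K := R_AbsRing)); auto.
  - intros x Hx. apply (continuous_scal_r (V := R_NormedModule)); auto.
  - intros x Hx. rewrite Rabs_mult, (Rabs_right (w x)) by (apply Rle_ge; auto).
    unfold scal; simpl; unfold mult; simpl. rewrite Rmult_comm.
    apply Rmult_le_compat_r; auto.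
  - now apply (is_RInt_gen_scal (Fa := Fa) (Fb := Fb) (V := R_NormedModule)). }
destruct Hex as [l Hl].
assert (Hd : forall N, Rabs (l - I N) <= e N * W).
{ intros N. apply (RInt_gen_abs_le (fun x => minus (w x * g x) (w x * gN N x)) (fun x => scal (e N) (w x))).
  - intros x Hx. unfold minus, plus, opp, scal; simpl; unfold mult; simpl.
    replace (w x * g x + - (w x * gN N x)) with ((g x - gN N x) * w x) by ring.
    rewrite Rabs_mult, (Rabs_right (w x)) by (apply Rle_ge; auto).
    apply Rmult_le_compat_r; auto.
  - apply (is_RInt_gen_minus (Fa := Fa) (Fb := Fb) _ _ _ _ Hl (HI N)).
  - now apply (is_RInt_gen_scal (Fa := Fa) (Fb := Fb) (V := R_NormedModule)). }
replace L with l; auto.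
assert (HIl : is_lim_seq I l).
{ apply is_lim_seq_le_le with (fun N => l - e N * W) (fun N => l + e N * W).
  - intros N. specialize (Hd N). apply Rabs_le_between in Hd. lra.
  - replace (Finite l) with (Finite (l - 0 * W)) by (f_equal; ring).
    apply is_lim_seq_minus'; [apply is_lim_seq_const | apply is_lim_seq_mult'; auto; apply is_lim_seq_const].
  - replace (Finite l) with (Finite (l + 0 * W)) by (f_equal; ring).
    apply is_lim_seq_plus'; [apply is_lim_seq_const | apply is_lim_seq_mult'; auto; apply is_lim_seq_const]. }
apply is_lim_seq_unique in HIL. apply is_lim_seq_unique in HIl. congruence.
Qed.

End Improper.

(** * The Gamma function *)

Lemma exp_le (x y : R) : x <= y -> exp x <= exp y.
Proof. intros [H|H]; [left; now apply exp_increasing | right; now f_equal]. Qed.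

Lemma Rpower_pos (x y : R) : 0 < Rpower x y.
Proof. apply exp_pos. Qed.

Lemma is_derive_Rpower (p x : R) : 0 < x ->
  is_derive (fun x => Rpower x p) x (p * Rpower x (p - 1)).
Proof. intros Hx. apply is_derive_Reals. now apply derivable_pt_lim_power. Qed.

Lemma continuous_Rpower (p x : R) : 0 < x -> continuous (fun x => Rpower x p) x.
Proof.
intros Hx. apply (ex_derive_continuous (K := R_AbsRing) (V := R_NormedModule)).
eexists; now apply is_derive_Rpower.
Qed.

Lemma Rpower_S_l (x p : R) : 0 < x -> Rpower x p = x * Rpower x (p - 1).
Proof.
intros Hx. rewrite <- (Rpower_1 x) at 2 by auto. rewrite <- Rpower_plus. f_equal; ring.
Qed.

(** One-sided by necessity, since [Rpower 0 p] is 1. *)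
Lemma filterlim_Rpower_0 (p : R) : 0 < p ->
  filterlim (fun x => Rpower x p) (at_right 0) (locally 0).
Proof.
intros Hp. apply filterlim_locally. intros eps.
exists (mkposreal _ (Rpower_pos eps (/ p))). intros y Hy Hy0.
change (Rabs (y - 0) < Rpower eps (/ p)) in Hy. change (Rabs (Rpower y p - 0) < eps).
rewrite Rminus_0_r in Hy |- *.
rewrite Rabs_right in Hy by lra.
rewrite Rabs_right by (left; apply Rpower_pos).
replace (pos eps) with (Rpower (Rpower eps (/ p)) p).
- apply Rlt_Rpower_l; auto.
- rewrite Rpower_mult, Rinv_l, Rpower_1 by (try lra; apply cond_pos). auto.
Qed.

(** Only half of the exponential decay is spent on the power, so exp (- t / 2) remains as an
    integrable majorant. *)
Lemma Rpower_le_exp (m : R) : 0 <= m ->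
  exists C, 0 < C /\ forall t, 0 < t -> Rpower t m <= C * exp (t / 2).
Proof.
(* From ln y <= y at y = t / (2 m + 1), multiplied by m; the divisor 2 m + 1 makes m / (2 m + 1) at
   most 1/2 and stays positive for m = 0. *)
intros Hm. exists (exp (m * ln (2 * m + 1))). split; [apply exp_pos|].
intros t Ht. rewrite <- exp_plus. apply exp_le.
assert (H : ln t <= ln (2 * m + 1) + t / (2 * m + 1)).
{ replace t with ((2 * m + 1) * (t / (2 * m + 1))) at 1 by (field; lra).
  rewrite ln_mult; [|lra|apply Rdiv_lt_0_compat; lra].
  apply Rplus_le_compat_l.
  assert (Hp : 0 < t / (2 * m + 1)) by (apply Rdiv_lt_0_compat; lra).
  generalize (exp_ineq1_le (ln (t / (2 * m + 1)))). rewrite exp_ln by auto. lra. }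
apply Rle_trans with (m * (ln (2 * m + 1) + t / (2 * m + 1))).
- now apply Rmult_le_compat_l.
- rewrite Rmult_plus_distr_l. apply Rplus_le_compat_l.
  replace (m * (t / (2 * m + 1))) with (t * (m / (2 * m + 1))) by (field; lra).
  unfold Rdiv at 2. apply Rmult_le_compat_l; [lra|].
  apply Rmult_le_reg_r with (2 * (2 * m + 1)); [lra|]. field_simplify; lra.
Qed.

Definition gamma_integrand (s t : R) : R := Rpower t (s - 1) * exp (- t).

Lemma continuous_exp_opp (x : R) : continuous (fun t => exp (- t)) x.
Proof.
apply (ex_derive_continuous (K := R_AbsRing) (V := R_NormedModule)). auto_derive; auto.
Qed.

Lemma continuous_gamma_integrand (s x : R) : 0 < x -> continuous (gamma_integrand s) x.
Proof.
intros Hx. apply (continuous_mult (K := R_AbsRing)).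
- now apply continuous_Rpower.
- apply continuous_exp_opp.
Qed.

Lemma gamma_integrand_pos (s x : R) : 0 < gamma_integrand s x.
Proof. apply Rmult_lt_0_compat; [apply Rpower_pos | apply exp_pos]. Qed.

Lemma gamma_integrand_S (s x : R) : 0 < x -> gamma_integrand (s + 1) x = x * gamma_integrand s x.
Proof.
intros Hx. unfold gamma_integrand. replace (s + 1 - 1) with s by ring.
rewrite (Rpower_S_l x s) by auto. ring.
Qed.

Lemma filterlim_exp_scal_infty (k : R) : 0 < k ->
  filterlim (fun t => exp (- (k * t))) (Rbar_locally p_infty) (locally 0).
Proof.
intros Hk. apply filterlim_locally. intros eps.
exists (- ln eps / k). intros x Hx.
change (Rabs (exp (- (k * x)) - 0) < eps).
rewrite Rminus_0_r, Rabs_right by (left; apply exp_pos).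
rewrite <- (exp_ln eps) by apply cond_pos. apply exp_increasing.
apply Rmult_lt_compat_l with (r := k) in Hx; auto.
replace (k * (- ln eps / k)) with (- ln eps) in Hx by (field; lra). lra.
Qed.

Lemma is_RInt_gen_exp_scal (k : R) : 0 < k ->
  is_RInt_gen (fun t => exp (- (k * t))) (at_right 0) (Rbar_locally p_infty) (/ k).
Proof.
intros Hk. replace (/ k) with (0 * - / k - - / k) by ring.
apply (is_RInt_gen_antiderivative interval_filters_half_line (fun t => exp (- (k * t)) * - / k)).
- intros x _. auto_derive; auto. field. lra.
- intros x _. apply (ex_derive_continuous (K := R_AbsRing) (V := R_NormedModule)). auto_derive; auto.
- apply filterlim_filter_le_1 with (1 := filter_le_within (F := locally 0) (fun u => 0 < u)).
  assert (Hc : continuous (fun t => exp (- (k * t)) * - / k) 0)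
    by (apply (ex_derive_continuous (K := R_AbsRing) (V := R_NormedModule)); auto_derive; auto).
  unfold continuous in Hc. rewrite Rmult_0_r, Ropp_0, exp_0, Rmult_1_l in Hc. exact Hc.
- eapply (filterlim_comp_2 (G := locally 0) (H := locally (- / k))).
  + now apply filterlim_exp_scal_infty.
  + apply filterlim_const.
  + apply (filterlim_mult (K := R_AbsRing)).
Qed.

Lemma Rpower_exp_lim_0 (s : R) : 0 < s ->
  filterlim (fun t => Rpower t s * exp (- t)) (at_right 0) (locally 0).
Proof.
intros Hs. replace (locally 0) with (locally (0 * exp (- 0))) by (f_equal; ring).
eapply filterlim_comp_2.
- now apply filterlim_Rpower_0.
- apply filterlim_filter_le_1 with (1 := filter_le_within (F := locally 0) (fun u => 0 < u)). apply (continuous_exp_opp 0).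
- apply (filterlim_mult (K := R_AbsRing)).
Qed.

Lemma Rpower_exp_lim_infty (s : R) : 0 <= s ->
  filterlim (fun t => Rpower t s * exp (- t)) (Rbar_locally p_infty) (locally 0).
Proof.
intros Hs. destruct (Rpower_le_exp s Hs) as [C [HC H]].
assert (Hl : filterlim (fun t => C * exp (- (/ 2 * t))) (Rbar_locally p_infty) (locally 0)).
{ replace (locally 0) with (locally (C * 0)) by (f_equal; ring).
  eapply filterlim_comp_2; [apply filterlim_const | apply filterlim_exp_scal_infty; lra |].
  apply (filterlim_mult (K := R_AbsRing)). }
apply (filterlim_le_le (F := Rbar_locally p_infty) (fun _ => 0) _ (fun t => C * exp (- (/ 2 * t))) 0); auto.
- exists 0. intros t Ht. split.
  + left; apply Rmult_lt_0_compat; [apply Rpower_pos | apply exp_pos].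
  + apply Rle_trans with (C * exp (t / 2) * exp (- t)).
    * apply Rmult_le_compat_r; [left; apply exp_pos | auto].
    * rewrite Rmult_assoc, <- exp_plus. right. f_equal. f_equal. field.
- apply filterlim_const.
Qed.

Notation is_half_line_int f l := (is_RInt_gen f (at_right 0) (Rbar_locally p_infty) l).

Lemma half_line_int_scal (f : R -> R) (k l : R) :
  is_half_line_int f l -> is_half_line_int (fun x => k * f x) (k * l).
Proof. apply (is_RInt_gen_scal (V := R_NormedModule)). Qed.

Lemma half_line_int_minus (f g : R -> R) (l m : R) :
  is_half_line_int f l -> is_half_line_int g m ->
  is_half_line_int (fun x => f x - g x) (l - m).
Proof. apply (is_RInt_gen_minus (V := R_NormedModule)). Qed.

(** The integrand is the derivative of t^s e^(-t), which vanishes at both ends. The recursion is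
    thus available before either integral is known to converge, and it serves to prove convergence
    as well as [Gamma_S]. *)
Lemma is_RInt_gen_gamma_by_parts (s : R) : 0 < s ->
  is_half_line_int (fun t => s * gamma_integrand s t - gamma_integrand (s + 1) t) 0.
Proof.
intros Hs. replace 0 with (0 - 0) at 2 by ring.
apply (is_RInt_gen_antiderivative interval_filters_half_line (fun t => Rpower t s * exp (- t))).
- intros x Hx. unfold gamma_integrand. replace (s + 1 - 1) with s by ring.
  replace (s * (Rpower x (s - 1) * exp (- x)) - Rpower x s * exp (- x))
    with (plus (mult (s * Rpower x (s - 1)) (exp (- x))) (mult (Rpower x s) (- exp (- x))))
    by (unfold plus, mult; simpl; ring).
  apply (is_derive_mult (K := R_AbsRing) (fun t => Rpower t s) (fun t => exp (- t))); [now apply is_derive_Rpower | auto_derive; auto; ring | apply Rmult_comm].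
- intros x Hx. apply (continuous_minus (V := R_NormedModule)).
  + apply (continuous_mult (K := R_AbsRing)); [apply continuous_const | now apply continuous_gamma_integrand].
  + now apply continuous_gamma_integrand.
- now apply Rpower_exp_lim_0.
- apply Rpower_exp_lim_infty; lra.
Qed.

(** [Gamma] is defined through the total operator [RInt_gen], so convergence has to be supplied. For
    s >= 1 the integrand is below C e^(-t/2); the singularity at 0 for s < 1 is avoided by
    integration by parts from s + 1. *)
Lemma is_RInt_gen_Gamma (s : R) : 0 < s -> is_half_line_int (gamma_integrand s) (Gamma s).
Proof.
assert (H1 : forall s, 1 <= s -> exists l, is_half_line_int (gamma_integrand s) l).
{ clear s. intros s Hs. destruct (Rpower_le_exp (s - 1) ltac:(lra)) as [C [HC H]].
  apply (ex_RInt_gen_dominated interval_filters_half_line _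
    (fun t => scal C (exp (- (/ 2 * t)))) (scal C (/ / 2))).
  - intros; now apply continuous_gamma_integrand.
  - intros x _. apply (ex_derive_continuous (K := R_AbsRing) (V := R_NormedModule)).
    unfold scal; simpl; unfold mult; simpl. auto_derive; auto.
  - intros x Hx. rewrite Rabs_right by (left; apply gamma_integrand_pos).
    apply Rle_trans with (C * exp (x / 2) * exp (- x)).
    * apply Rmult_le_compat_r; [left; apply exp_pos | auto].
    * rewrite Rmult_assoc, <- exp_plus. right. unfold scal; simpl; unfold mult; simpl. f_equal. f_equal. field.
  - apply (is_RInt_gen_scal (V := R_NormedModule)). apply is_RInt_gen_exp_scal. lra. }
assert (H2 : forall s, 0 < s -> exists l, is_half_line_int (gamma_integrand s) l).
{ clear s. intros s Hs. destruct (H1 (s + 1) ltac:(lra)) as [l Hl].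
  eexists.
  refine (is_RInt_gen_ext_on interval_filters_half_line _ _ _ _ (is_RInt_gen_scal _ (/ s) _ (is_RInt_gen_plus _ _ _ _ (is_RInt_gen_gamma_by_parts s Hs) Hl))).
  intros x _. unfold scal, plus; simpl; unfold mult; simpl. field; lra. }
intros Hs. destruct (H2 s Hs) as [l Hl].
unfold Gamma.
replace (RInt_gen _ _ _) with l; auto.
symmetry. apply (is_RInt_gen_unique (V := R_CompleteNormedModule)). exact Hl.
Qed.

Lemma half_line_int_unique (f : R -> R) (l1 l2 : R) :
  is_half_line_int f l1 -> is_half_line_int f l2 -> l1 = l2.
Proof.
intros H1 H2. rewrite <- (is_RInt_gen_unique (V := R_CompleteNormedModule) _ _ H1).
now apply (is_RInt_gen_unique (V := R_CompleteNormedModule)).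
Qed.

Lemma Gamma_S (s : R) : 0 < s -> Gamma (s + 1) = s * Gamma s.
Proof.
intros Hs.
assert (H := half_line_int_unique _ _ _ (is_RInt_gen_gamma_by_parts s Hs)
  (is_RInt_gen_minus _ _ _ _ (is_RInt_gen_scal _ s _ (is_RInt_gen_Gamma s Hs))
  (is_RInt_gen_Gamma (s + 1) ltac:(lra)))).
unfold minus, plus, opp, scal in H; simpl in H; unfold mult in H; simpl in H. lra.
Qed.

Lemma Gamma_1 : Gamma 1 = 1.
Proof.
apply (half_line_int_unique (gamma_integrand 1)); [apply is_RInt_gen_Gamma; lra|].
replace 1 with (/ 1) at 2 by field.
refine (is_RInt_gen_ext_on interval_filters_half_line _ _ _ _ (is_RInt_gen_exp_scal 1 ltac:(lra))).
intros x Hx. unfold gamma_integrand. replace (1 - 1) with 0 by ring.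
rewrite Rpower_O, !Rmult_1_l by auto. auto.
Qed.

(** Comparing integrands only yields weak inequalities, so for s >= 2 the integrand is bounded below
    by c (t - 1/2) e^(-t), whose integral c (Gamma 2 - Gamma 1 / 2) = c / 2 is explicit and
    positive. Smaller s follow by applying the recursion twice. *)
Lemma Gamma_pos (s : R) : 0 < s -> 0 < Gamma s.
Proof.
assert (H2 : forall s, 2 <= s -> 0 < Gamma s).
{ clear s. intros s Hs.
  set (c := Rpower (/ 2) (s - 1)).
  assert (Hc : 0 < c) by apply Rpower_pos.
  assert (Hc1 : c <= 1).
  { unfold c. apply Rle_trans with (Rpower (/ 2) 0); [|rewrite Rpower_O; lra]. unfold Rpower. apply exp_le.
    assert (ln (/ 2) < ln 1) by (apply ln_increasing; lra).
    rewrite ln_1 in H. rewrite Rmult_0_l, <- (Rmult_0_r (s - 1)). apply Rmult_le_compat_l; lra. }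
  apply Rlt_le_trans with (c * (1 - / 2)); [nra|].
  assert (G2 : Gamma (1 + 1) = 1) by (rewrite Gamma_S, Gamma_1; lra).
  refine (RInt_gen_le interval_filters_half_line (fun t => scal c (minus (gamma_integrand (1 + 1) t) (scal (/ 2) (gamma_integrand 1 t)))) _ _ _ _ _ (is_RInt_gen_Gamma s ltac:(lra))).
  2:{ replace (c * (1 - / 2)) with (scal c (minus (Gamma (1 + 1)) (scal (/ 2) (Gamma 1)))).
      - apply (is_RInt_gen_scal (V := R_NormedModule)). apply (is_RInt_gen_minus (V := R_NormedModule)).
        + apply is_RInt_gen_Gamma; lra.
        + apply (is_RInt_gen_scal (V := R_NormedModule)). apply is_RInt_gen_Gamma; lra.
      - rewrite G2, Gamma_1. unfold scal, minus, plus, opp; simpl; unfold mult; simpl. ring. }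
  intros x Hx. rewrite gamma_integrand_S by auto.
  unfold scal, minus, plus, opp; simpl; unfold mult; simpl.
  replace (c * (x * gamma_integrand 1 x + - (/ 2 * gamma_integrand 1 x)))
    with (c * (x - / 2) * gamma_integrand 1 x) by ring.
  unfold gamma_integrand. replace (1 - 1) with 0 by ring. rewrite Rpower_O, Rmult_1_l by auto.
  apply Rmult_le_compat_r; [left; apply exp_pos|].
  (* Up to 1/2 the lower bound is nonpositive; on (1/2, 1] it is at most c, the value of the power
     at 1/2; beyond 1 the power is at least x because s - 1 >= 1. *)
  destruct (Rle_dec x (/ 2)).
  { generalize (Rpower_pos x (s - 1)). nra. }
  destruct (Rle_dec x 1).
  { apply Rle_trans with c; [nra|]. unfold c. apply Rle_Rpower_l; lra. }
  apply Rle_trans with (Rpower x 1); [rewrite Rpower_1 by auto; apply Rle_trans with (1 * (x - / 2)); [apply Rmult_le_compat_r|]; lra|].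
  apply Rle_Rpower; lra. }
intros Hs. assert (H := H2 (s + 1 + 1) ltac:(lra)).
rewrite !Gamma_S in H by lra.
apply Rmult_lt_reg_l with ((s + 1) * s); [nra|]. lra.
Qed.

(* Chebyshev's integral inequality for the weight t^(x-1) e^(-t) and the increasing functions t^q and t^(y-x): subtracting from t^q its weighted mean, attained at t = t0, and from t^(y-x) its value at t0, makes the product of the two differences nonnegative. *)
Lemma Gamma_cross_le (x y q : R) : 0 < x <= y -> 0 < q ->
  Gamma (x + q) * Gamma y <= Gamma (y + q) * Gamma x.
Proof.
intros [Hx Hxy] Hq.
assert (Px := Gamma_pos x Hx).
assert (Pxq := Gamma_pos (x + q) ltac:(lra)).
set (f0 := Gamma (x + q) / Gamma x).
assert (Hf0 : 0 < f0) by (apply Rdiv_lt_0_compat; auto).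
set (t0 := Rpower f0 (/ q)).
assert (Ht0 : 0 < t0) by apply Rpower_pos.
assert (Et0 : Rpower t0 q = f0).
{ unfold t0. rewrite Rpower_mult, Rinv_l, Rpower_1 by lra. auto. }
set (g0 := Rpower t0 (y - x)).
assert (H : 0 <= (Gamma (y + q) - f0 * Gamma y) - g0 * (Gamma (x + q) - f0 * Gamma x)).
{ refine (RInt_gen_le interval_filters_half_line (fun t => scal 0 (gamma_integrand x t)) (fun t => minus
    (minus (gamma_integrand (y + q) t) (scal f0 (gamma_integrand y t)))
    (scal g0 (minus (gamma_integrand (x + q) t) (scal f0 (gamma_integrand x t))))) _ _ _ _ _).
  - intros t Ht. unfold gamma_integrand.
    replace (Rpower t (y + q - 1)) with (Rpower t (x - 1) * Rpower t (y - x) * Rpower t q)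
      by (rewrite <- !Rpower_plus; f_equal; ring).
    replace (Rpower t (x + q - 1)) with (Rpower t (x - 1) * Rpower t q)
      by (rewrite <- !Rpower_plus; f_equal; ring).
    replace (Rpower t (y - 1)) with (Rpower t (x - 1) * Rpower t (y - x))
      by (rewrite <- !Rpower_plus; f_equal; ring).
    unfold scal, minus, plus, opp; simpl; unfold mult; simpl.
    assert (HW := Rmult_lt_0_compat _ _ (Rpower_pos t (x - 1)) (exp_pos (- t))).
    assert (HP : 0 <= (Rpower t q - f0) * (Rpower t (y - x) - g0)).
    { rewrite <- Et0. unfold g0. destruct (Rle_dec t t0) as [h|h].
      - assert (Rpower t q <= Rpower t0 q) by (apply Rle_Rpower_l; lra).
        assert (Rpower t (y - x) <= Rpower t0 (y - x)) by (apply Rle_Rpower_l; lra).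
        nra.
      - assert (Rpower t0 q <= Rpower t q) by (apply Rle_Rpower_l; lra).
        assert (Rpower t0 (y - x) <= Rpower t (y - x)) by (apply Rle_Rpower_l; lra).
        nra. }
    assert (HH := Rmult_le_pos _ _ (Rlt_le _ _ HW) HP). nra.
  - refine (eq_rect _ (fun l => is_half_line_int _ l) _ _ (Rmult_0_l (Gamma x))).
    apply (is_RInt_gen_scal (V := R_NormedModule)). now apply is_RInt_gen_Gamma.
  - assert (H1 := is_RInt_gen_Gamma (x + q) ltac:(lra)).
    assert (H2 := half_line_int_scal _ f0 _ (is_RInt_gen_Gamma x ltac:(lra))).
    assert (H3 := is_RInt_gen_Gamma (y + q) ltac:(lra)).
    assert (H4 := half_line_int_scal _ f0 _ (is_RInt_gen_Gamma y ltac:(lra))).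
    exact (half_line_int_minus _ _ _ _ (half_line_int_minus _ _ _ _ H3 H4)
      (half_line_int_scal _ g0 _ (half_line_int_minus _ _ _ _ H1 H2))). }
replace (Gamma (x + q) - f0 * Gamma x) with 0 in H by (unfold f0; field; lra).
assert (E : Gamma (x + q) = f0 * Gamma x) by (unfold f0; field; lra).
rewrite E. nra.
Qed.

(* From t^a >= M^a (1 - M/t) with M = (p - a)/2. *)
Lemma Gamma_ratio_lower (a p : R) : 0 < a -> a < p ->
  Rpower ((p - a) / 2) a / 2 <= Gamma (p + 1) / Gamma (p + 1 - a).
Proof.
intros Ha Hp. set (M := (p - a) / 2). assert (HM : 0 < M) by (unfold M; lra).
set (K := Rpower M a). assert (HK : 0 < K) by apply Rpower_pos.
replace (p + 1 - a) with (p - a + 1) by ring.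
assert (P : 0 < Gamma (p - a + 1)) by (apply Gamma_pos; lra).
assert (H : K * (Gamma (p - a + 1) - M * Gamma (p - a)) <= Gamma (p + 1)).
{ refine (RInt_gen_le interval_filters_half_line (fun t => scal K (minus (gamma_integrand (p - a + 1) t) (scal M (gamma_integrand (p - a) t)))) _ _ _ _ _ (is_RInt_gen_Gamma (p + 1) ltac:(lra))).
  - intros t Ht. unfold gamma_integrand.
    replace (p - a + 1 - 1) with (p - a) by ring. replace (p + 1 - 1) with p by ring.
    replace (Rpower t p) with (Rpower t a * Rpower t (p - a)) by (rewrite <- Rpower_plus; f_equal; ring).
    rewrite (Rpower_S_l t (p - a)) by auto.
    unfold scal, minus, plus, opp; simpl; unfold mult; simpl.
    assert (HW := Rmult_lt_0_compat _ _ (Rpower_pos t (p - a - 1)) (exp_pos (- t))).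
    set (w := Rpower t (p - a - 1)) in *. set (z := exp (- t)) in *.
    replace (K * (t * w * z + - (M * (w * z)))) with (K * (t - M) * (w * z)) by ring.
    replace (Rpower t a * (t * w) * z) with (Rpower t a * t * (w * z)) by ring.
    apply Rmult_le_compat_r; [lra|].
    assert (HT := Rpower_pos t a).
    destruct (Rle_dec t M) as [h|h]; [nra|].
    assert (K <= Rpower t a) by (apply Rle_Rpower_l; lra). nra.
  - assert (H1 := is_RInt_gen_Gamma (p - a + 1) ltac:(lra)).
    assert (H2 := half_line_int_scal _ M _ (is_RInt_gen_Gamma (p - a) ltac:(lra))).
    exact (half_line_int_scal _ K _ (half_line_int_minus _ _ _ _ H1 H2)). }
apply Rmult_le_reg_r with (Gamma (p - a + 1)); auto.
unfold Rdiv at 2. rewrite Rmult_assoc, Rinv_l, Rmult_1_r by lra.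
apply Rle_trans with (2 := H).
rewrite (Gamma_S (p - a)) by lra. right. unfold M. field.
Qed.

(** * The Beta integral *)

Section Segment.

Context (t a : R) (Ht : 0 < t) (Ha : 0 < a < 1).

Notation seg_int f l := (is_RInt_gen f (at_right 0) (at_left t) l).

Let HD := interval_filters_segment t Ht.

Lemma seg_int_scal (f : R -> R) (k l : R) :
  seg_int f l -> seg_int (fun x => k * f x) (k * l).
Proof. apply (is_RInt_gen_scal (V := R_NormedModule)). Qed.

Lemma seg_int_plus (f g : R -> R) (l m : R) :
  seg_int f l -> seg_int g m -> seg_int (fun x => f x + g x) (l + m).
Proof. apply (is_RInt_gen_plus (V := R_NormedModule)). Qed.

Lemma seg_int_minus (f g : R -> R) (l m : R) :
  seg_int f l -> seg_int g m -> seg_int (fun x => f x - g x) (l - m).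
Proof. apply (is_RInt_gen_minus (V := R_NormedModule)). Qed.

Lemma seg_int_unique (f : R -> R) (l m : R) : seg_int f l -> seg_int f m -> l = m.
Proof.
intros H1 H2. rewrite <- (is_RInt_gen_unique (V := R_CompleteNormedModule) _ _ H1).
now apply (is_RInt_gen_unique (V := R_CompleteNormedModule)).
Qed.

Definition abel_kernel (s : R) : R := Rpower (t - s) (- a).

Lemma is_derive_Rpower_sub (p s : R) : s < t ->
  is_derive (fun s => Rpower (t - s) p) s (- (p * Rpower (t - s) (p - 1))).
Proof.
intros Hs.
replace (- (p * Rpower (t - s) (p - 1))) with (scal (-1) (p * Rpower (t - s) (p - 1)))
  by (unfold scal; simpl; unfold mult; simpl; ring).
apply (is_derive_comp (K := R_AbsRing) (V := R_NormedModule) (fun x => Rpower x p) (fun s => t - s)).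
- apply is_derive_Rpower. lra.
- auto_derive; auto; ring.
Qed.

Lemma continuous_abel_kernel (s : R) : 0 < s < t -> continuous abel_kernel s.
Proof.
intros Hs. apply (ex_derive_continuous (K := R_AbsRing) (V := R_NormedModule)).
eexists; apply is_derive_Rpower_sub; lra.
Qed.

Lemma filterlim_sub_at_left : filterlim (fun s => t - s) (at_left t) (at_right 0).
Proof.
intros P [eps He]. exists eps. intros y Hy Hyt. apply He; [|lra].
change (Rabs (y - t) < eps) in Hy. change (Rabs (t - y - 0) < eps).
now rewrite Rminus_0_r, Rabs_minus_sym.
Qed.

(** The integrand is the derivative of s^p (t - s)^(1 - a), with (t - s)^(1 - a) expanded as (t - s)
    (t - s)^(-a) so that only moments of the same kernel occur. It is the recursion of the Beta
    function in its first argument. *)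
Lemma is_RInt_gen_abel_by_parts (p : R) : 0 < p ->
  seg_int (fun s => p * t * (abel_kernel s * Rpower s (p - 1))
    - (p + 1 - a) * (abel_kernel s * Rpower s (p + 1 - 1))) 0.
Proof.
(* The zero is written as the difference of the boundary terms: (t - s)^(1 - a) tends to 0 at t, and
   s^p tends to 0 at 0. *)
intros Hp. replace 0 with (Rpower t p * 0 - 0 * Rpower (t - 0) (1 - a)) at 2 by ring.
apply (is_RInt_gen_antiderivative HD (fun s => Rpower s p * Rpower (t - s) (1 - a))).
- intros x Hx.
  replace (p * t * (abel_kernel x * Rpower x (p - 1))
    - (p + 1 - a) * (abel_kernel x * Rpower x (p + 1 - 1)))
    with (plus (mult (p * Rpower x (p - 1)) (Rpower (t - x) (1 - a)))
      (mult (Rpower x p) (- ((1 - a) * Rpower (t - x) (1 - a - 1))))).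
  + apply (is_derive_mult (K := R_AbsRing) (fun s => Rpower s p) (fun s => Rpower (t - s) (1 - a))).
    * apply is_derive_Rpower; lra.
    * apply is_derive_Rpower_sub; lra.
    * apply Rmult_comm.
  + unfold plus, mult; simpl. unfold abel_kernel.
    rewrite (Rpower_S_l (t - x) (1 - a)) by lra.
    replace (1 - a - 1) with (- a) by ring.
    replace (p + 1 - 1) with p by ring.
    rewrite (Rpower_S_l x p) by lra. ring.
- intros x Hx.
  assert (H : forall p k, continuous (fun s => k * (abel_kernel s * Rpower s p)) x).
  { intros q k. apply (continuous_scal_r (V := R_NormedModule) k (fun s => abel_kernel s * Rpower s q)).
    apply (continuous_mult (K := R_AbsRing) abel_kernel (fun s => Rpower s q));
      [now apply continuous_abel_kernel | apply continuous_Rpower; lra]. }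
  exact (continuous_minus (V := R_NormedModule) _ _ x (H (p - 1) (p * t)) (H (p + 1 - 1) (p + 1 - a))).
- eapply filterlim_comp_2.
  + now apply filterlim_Rpower_0.
  + apply filterlim_filter_le_1 with (1 := filter_le_within (F := locally 0) (fun u => 0 < u)).
    apply (ex_derive_continuous (K := R_AbsRing) (V := R_NormedModule) (fun s => Rpower (t - s) (1 - a)) 0).
    eexists; apply is_derive_Rpower_sub; lra.
  + apply (filterlim_mult (K := R_AbsRing)).
- eapply filterlim_comp_2.
  + apply filterlim_filter_le_1 with (1 := filter_le_within (F := locally t) (fun u => u < t)).
    now apply (continuous_Rpower p t).
  + exact (filterlim_comp _ _ _ (fun s => t - s) (fun x => Rpower x (1 - a)) _ _ _
      filterlim_sub_at_left (filterlim_Rpower_0 (1 - a) ltac:(lra))).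
  + apply (filterlim_mult (K := R_AbsRing)).
Qed.

Lemma is_RInt_gen_abel_kernel : seg_int abel_kernel (Rpower t (1 - a) / (1 - a)).
Proof.
assert (H := is_RInt_gen_antiderivative HD (fun s => Rpower (t - s) (1 - a) * - / (1 - a))
  abel_kernel (Rpower (t - 0) (1 - a) * - / (1 - a)) (0 * - / (1 - a))).
replace (Rpower t (1 - a) / (1 - a)) with
  (0 * - / (1 - a) - Rpower (t - 0) (1 - a) * - / (1 - a)).
2:{ replace (t - 0) with t by ring. field. lra. }
apply H.
- intros x Hx.
  replace (abel_kernel x) with (- ((1 - a) * Rpower (t - x) (1 - a - 1)) * - / (1 - a)).
  + apply (is_derive_scal_l (K := R_AbsRing) (V := R_NormedModule)).
    apply is_derive_Rpower_sub; lra.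
  + unfold abel_kernel. replace (1 - a - 1) with (- a) by ring. field; lra.
- apply continuous_abel_kernel.
- eapply filterlim_comp_2; [|apply filterlim_const|apply (filterlim_mult (K := R_AbsRing))].
  apply filterlim_filter_le_1 with (1 := filter_le_within (F := locally 0) (fun u => 0 < u)).
  apply (ex_derive_continuous (K := R_AbsRing) (V := R_NormedModule) (fun s => Rpower (t - s) (1 - a)) 0).
  eexists; apply is_derive_Rpower_sub; lra.
- eapply filterlim_comp_2; [|apply filterlim_const|apply (filterlim_mult (K := R_AbsRing))].
  exact (filterlim_comp _ _ _ (fun s => t - s) (fun x => Rpower x (1 - a)) _ _ _
      filterlim_sub_at_left (filterlim_Rpower_0 (1 - a) ltac:(lra))).
Qed.

(** Equal to t^(p - a) B(p, 1 - a), with B the Beta function. *)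
Definition abel_moment (p : R) : R :=
  RInt_gen (fun s => abel_kernel s * Rpower s (p - 1)) (at_right 0) (at_left t).

Lemma abel_kernel_pos (s : R) : 0 < abel_kernel s.
Proof. apply Rpower_pos. Qed.

(** For p >= 1 the factor s^(p - 1) is bounded by t^(p - 1), so the kernel alone is a majorant. All
    exponents in the solution satisfy this bound. *)
Lemma is_RInt_gen_abel_moment (p : R) : 1 <= p ->
  seg_int (fun s => abel_kernel s * Rpower s (p - 1)) (abel_moment p).
Proof.
intros Hp.
assert (H : exists l, seg_int (fun s => abel_kernel s * Rpower s (p - 1)) l).
{ refine (ex_RInt_gen_dominated HD _ _ _ _ _ _ (seg_int_scal _ (Rpower t (p - 1)) _ is_RInt_gen_abel_kernel)).
  - intros x Hx. apply (continuous_mult (K := R_AbsRing)); [now apply continuous_abel_kernel|].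
    apply continuous_Rpower; lra.
  - intros x Hx. apply (continuous_mult (K := R_AbsRing)); [apply continuous_const|].
    now apply continuous_abel_kernel.
  - intros x Hx. assert (K := abel_kernel_pos x). assert (K' := Rpower_pos x (p - 1)).
    rewrite Rabs_right by (apply Rle_ge, Rmult_le_pos; lra).
    rewrite Rmult_comm. apply Rmult_le_compat_r; [lra|]. apply Rle_Rpower_l; lra. }
destruct H as [l Hl]. unfold abel_moment.
rewrite (is_RInt_gen_unique (V := R_CompleteNormedModule) _ _ Hl). exact Hl.
Qed.

Lemma abel_moment_S (p : R) : 1 <= p ->
  (p + 1 - a) * abel_moment (p + 1) = p * t * abel_moment p.
Proof.
intros Hp.
assert (H := seg_int_unique _ _ _ (is_RInt_gen_abel_by_parts p ltac:(lra))
  (seg_int_minus _ _ _ _ (seg_int_scal _ (p * t) _ (is_RInt_gen_abel_moment p Hp))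
    (seg_int_scal _ (p + 1 - a) _ (is_RInt_gen_abel_moment (p + 1) ltac:(lra))))).
lra.
Qed.

Lemma abel_moment_1 : abel_moment 1 = Rpower t (1 - a) / (1 - a).
Proof.
apply (seg_int_unique _ _ _ (is_RInt_gen_abel_moment 1 (Rle_refl 1))).
refine (is_RInt_gen_ext_on HD _ _ _ _ is_RInt_gen_abel_kernel).
intros x Hx. replace (1 - 1) with 0 by ring. rewrite Rpower_O by lra. ring.
Qed.

(** From s < t. Normalised by t^(-p), the moments are nonincreasing in p, which is one of the two
    monotonicities behind the Beta integral. *)
Lemma abel_moment_le (p q : R) : 1 <= p <= q ->
  abel_moment q <= Rpower t (q - p) * abel_moment p.
Proof.
intros Hpq.
refine (RInt_gen_le HD _ _ _ _ _ (is_RInt_gen_abel_moment q ltac:(lra))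
  (seg_int_scal _ (Rpower t (q - p)) _ (is_RInt_gen_abel_moment p ltac:(lra)))).
intros x Hx.
replace (Rpower x (q - 1)) with (Rpower x (q - p) * Rpower x (p - 1))
  by (rewrite <- Rpower_plus; f_equal; ring).
assert (K := abel_kernel_pos x). assert (K' := Rpower_pos x (p - 1)).
replace (abel_kernel x * (Rpower x (q - p) * Rpower x (p - 1)))
  with (Rpower x (q - p) * (abel_kernel x * Rpower x (p - 1))) by ring.
apply Rmult_le_compat_r; [apply Rmult_le_pos; lra|]. apply Rle_Rpower_l; lra.
Qed.

Lemma abel_moment_nonneg (p : R) : 1 <= p -> 0 <= abel_moment p.
Proof.
intros Hp. replace 0 with (0 * abel_moment p) by ring.
refine (RInt_gen_le HD _ _ _ _ _ (seg_int_scal _ 0 _ (is_RInt_gen_abel_moment p Hp))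
  (is_RInt_gen_abel_moment p Hp)).
intros x Hx. rewrite Rmult_0_l.
apply Rmult_le_pos; left; [apply abel_kernel_pos | apply Rpower_pos].
Qed.

End Segment.

Lemma Rle_of_le_mult_inv (u v : R) : 0 <= v ->
  (forall n : nat, u <= v * (1 + / (INR n + 1))) -> u <= v.
Proof.
intros Hv H. apply Rnot_lt_le. intros Huv.
destruct (nfloor_ex (v / (u - v))) as [n Hn]; [apply Rdiv_le_0_compat; lra|].
specialize (H n).
assert (Hp : 0 < INR n + 1) by (generalize (pos_INR n); lra).
assert (Hd : v < (INR n + 1) * (u - v)).
{ replace v with (v / (u - v) * (u - v)) at 1 by (field; lra).
  apply Rmult_lt_compat_r; lra. }
assert (Hm : (u - v) * (INR n + 1) <= v).
{ replace v with (v * / (INR n + 1) * (INR n + 1)) at 2 by (field; lra).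
  apply Rmult_le_compat_r; lra. }
lra.
Qed.

(** Shifting x and y by n does not change r, while the factor becomes 1 + 1 / (x + n); letting n
    grow, r is nonincreasing over steps of length at most 1. Periodicity reverses the inequality: r
    x = r (x + 1) <= r y. *)
Lemma periodic_squeeze (r : R -> R) :
  (forall p, 1 <= p -> r (p + 1) = r p) -> (forall p, 1 <= p -> 0 <= r p) ->
  (forall x y, 1 <= x <= y -> y <= x + 1 -> r y <= r x * (1 + / x)) ->
  forall p, 1 <= p -> r p = r 1.
Proof.
intros Hper Hpos Hle.
assert (HN : forall n p, 1 <= p -> r (p + INR n) = r p).
{ induction n as [|n IH]; intros p Hp; [now rewrite Rplus_0_r|].
  rewrite S_INR, <- Rplus_assoc, Hper; auto. generalize (pos_INR n); lra. }
assert (Hs : forall x y, 1 <= x <= y -> y <= x + 1 -> r y <= r x).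
{ intros x y Hx Hy. apply Rle_of_le_mult_inv; [apply Hpos; lra|]. intros n.
  rewrite <- (HN n x), <- (HN n y) by lra.
  generalize (pos_INR n); intros Hn.
  apply Rle_trans with (1 := Hle (x + INR n) (y + INR n) ltac:(lra) ltac:(lra)).
  apply Rmult_le_compat_l; [apply Hpos; lra|]. apply Rplus_le_compat_l.
  apply Rinv_le_contravar; lra. }
assert (He : forall x y, 1 <= x <= y -> y <= x + 1 -> r y = r x).
{ intros x y Hx Hy. apply Rle_antisym; [now apply Hs|].
  rewrite <- (Hper x) by lra. apply Hs; lra. }
(* The integer part of p - 1 moves the base point 1 to within one unit of p. *)
intros p Hp. destruct (nfloor_ex (p - 1)) as [n Hn]; [lra|].
rewrite <- (HN n 1) by lra. generalize (pos_INR n); intros Hn'. apply He; lra.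
Qed.

(* Euler's Beta integral on [0, t]. The ratio of its two sides is 1-periodic in p, and by monotonicity in p of the moments and of Gamma(p+1-a)/Gamma(p) it varies by a factor of at most 1 + 1/p over a period, so it is constant. *)
Lemma abel_moment_eq (t a p : R) : 0 < t -> 0 < a < 1 -> 1 <= p ->
  abel_moment t a p = Rpower t (p - a) * Gamma p * Gamma (1 - a) / Gamma (p + 1 - a).
Proof.
intros Ht Ha Hp.
set (r := fun p => abel_moment t a p * Rpower t (- p) * (Gamma (p + (1 - a)) / Gamma p)).
assert (Hr : r p = r 1).
{ apply periodic_squeeze; auto; clear p Hp; unfold r.
  - intros p Hp.
    assert (P1 := Gamma_pos p ltac:(lra)).
    replace (p + 1 + (1 - a)) with (p + (1 - a) + 1) by ring. rewrite !Gamma_S by lra.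
    assert (H := abel_moment_S t a Ht Ha p Hp).
    replace (abel_moment t a (p + 1)) with (p * t * abel_moment t a p / (p + 1 - a))
      by (rewrite <- H; field; lra).
    rewrite (Rpower_S_l t (- p)) by auto.
    replace (- p - 1) with (- (p + 1)) by ring. field. lra.
  - intros p Hp. apply Rmult_le_pos; [apply Rmult_le_pos|].
    + now apply abel_moment_nonneg.
    + left; apply Rpower_pos.
    + left; apply Rdiv_lt_0_compat; apply Gamma_pos; lra.
  - intros x y Hx Hy.
    assert (Px := Gamma_pos x ltac:(lra)). assert (Py := Gamma_pos y ltac:(lra)).
    assert (Pyq := Gamma_pos (y + (1 - a)) ltac:(lra)).
    assert (Pxq := Gamma_pos (x + (1 - a)) ltac:(lra)).
    assert (HM := abel_moment_le t a Ht Ha x y Hx).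
    (* Since y <= x + 1, the ratio at y is at most the ratio at x + 1, which the recursion rewrites
       as (x + 1 - a) / x times the ratio at x. *)
    assert (HG : Gamma (y + (1 - a)) / Gamma y <= Gamma (x + (1 - a)) / Gamma x * (1 + / x)).
    { assert (H := Gamma_cross_le y (x + 1) (1 - a) ltac:(lra) ltac:(lra)).
      replace (x + 1 + (1 - a)) with (x + (1 - a) + 1) in H by ring. rewrite !Gamma_S in H by lra.
      apply Rle_trans with ((x + (1 - a)) * Gamma (x + (1 - a)) / (x * Gamma x)).
      - apply Rmult_le_reg_r with (Gamma y * (x * Gamma x)).
        + apply Rmult_lt_0_compat; auto. apply Rmult_lt_0_compat; lra.
        + field_simplify; [|lra|lra]. lra.
      - apply Rmult_le_reg_r with (x * Gamma x); [apply Rmult_lt_0_compat; lra|].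
        field_simplify; [|lra|lra]. nra. }
    replace (abel_moment t a x * Rpower t (- x) * (Gamma (x + (1 - a)) / Gamma x) * (1 + / x))
      with (abel_moment t a x * Rpower t (- x) * (Gamma (x + (1 - a)) / Gamma x * (1 + / x))) by ring.
    apply Rmult_le_compat; auto.
    + apply Rmult_le_pos; [apply abel_moment_nonneg; lra | left; apply Rpower_pos].
    + left; apply Rdiv_lt_0_compat; lra.
    + replace (Rpower t (- x)) with (Rpower t (y - x) * Rpower t (- y))
        by (rewrite <- Rpower_plus; f_equal; ring).
      rewrite <- Rmult_assoc, (Rmult_comm _ (Rpower t (y - x))).
      apply Rmult_le_compat_r; auto. left; apply Rpower_pos. }
assert (Pp := Gamma_pos p ltac:(lra)). assert (Pq := Gamma_pos (p + (1 - a)) ltac:(lra)).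
replace (p + 1 - a) with (p + (1 - a)) by ring.
unfold r in Hr. rewrite abel_moment_1, (Rplus_comm 1 (1 - a)), Gamma_S, Gamma_1 in Hr by lra.
replace (abel_moment t a p) with (abel_moment t a p * Rpower t (- p) * (Gamma (p + (1 - a)) / Gamma p)
  * (Rpower t p * (Gamma p / Gamma (p + (1 - a))))).
- rewrite Hr. replace (p - a) with ((1 - a) + - (1) + p) by ring.
  rewrite !Rpower_plus. field. lra.
- replace (abel_moment t a p * Rpower t (- p) * (Gamma (p + (1 - a)) / Gamma p)
  * (Rpower t p * (Gamma p / Gamma (p + (1 - a)))))
  with (abel_moment t a p * (Rpower t (- p) * Rpower t p)) by (field; lra).
  rewrite <- Rpower_plus. replace (- p + p) with 0 by ring. rewrite Rpower_O by auto. ring.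
Qed.

(** * Entire power series times a real power *)

(** The right side does not involve [u]: when the terms depend on a point s and [v] does not, the
    error is uniform in s. *)
Lemma Series_tail_le (u v : nat -> R) (N : nat) :
  (forall n, Rabs (u n) <= v n) -> ex_series v ->
  Rabs (Series u - sum_n u N) <= Series v - sum_n v N.
Proof.
intros H Hv.
assert (Hu : ex_series (fun n => Rabs (u n))).
{ apply (ex_series_le (K := R_AbsRing) (V := R_CompleteNormedModule)) with v; auto.
  intros n. unfold norm; simpl. unfold abs; simpl. now rewrite Rabs_Rabsolu. }
assert (Hu' : ex_series u) by now apply ex_series_Rabs.
rewrite (Series_incr_n u (S N)), (Series_incr_n v (S N)) by (auto; lia).
rewrite !sum_n_Reals. simpl pred.
replace (sum_f_R0 u N + Series (fun k => u (S N + k)%nat) - sum_f_R0 u N)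
  with (Series (fun k => u (S N + k)%nat)) by ring.
replace (sum_f_R0 v N + Series (fun k => v (S N + k)%nat) - sum_f_R0 v N)
  with (Series (fun k => v (S N + k)%nat)) by ring.
apply Rle_trans with (Series (fun k => Rabs (u (S N + k)%nat))).
- apply Series_Rabs. now apply (ex_series_incr_n (fun n => Rabs (u n))).
- apply Series_le; [|now apply (ex_series_incr_n v)].
  intros n; split; [apply Rabs_pos | auto].
Qed.

(** Coefficients of the derivative of s^b times the power series of [r], once s^(b - 1) is factored
    out. *)
Definition shifted_coef (b : R) (r : nat -> R) (n : nat) : R := (INR n + b) * r n.

(** The eigenvalue lambda_p of the operator on t^p. *)
Definition Lfrac_factor (a p : R) : R := Gamma (2 - a) * (Gamma (p + 1) / Gamma (p + 1 - a)).

Section EntireSeries.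

Context (b : R) (r : nat -> R) (Hb : 1 <= b) (Hr : CV_radius r = p_infty).

(** Writes the new series as b r(s) + s r'(s), so that its radius and its sum follow from those of
    [r] and of its derivative. *)
Lemma shifted_coef_ext (n : nat) :
  shifted_coef b r n = PS_plus (PS_scal b r) (PS_incr_1 (PS_derive r)) n.
Proof.
unfold shifted_coef, PS_plus, PS_scal, PS_incr_1, PS_derive.
destruct n as [|n]; unfold plus, scal, zero; simpl; unfold mult; simpl; ring.
Qed.

Lemma CV_radius_shifted_coef : CV_radius (shifted_coef b r) = p_infty.
Proof.
rewrite (CV_radius_ext _ _ shifted_coef_ext).
assert (H := CV_radius_plus (PS_scal b r) (PS_incr_1 (PS_derive r))).
rewrite CV_radius_scal, CV_radius_incr_1, CV_radius_derive, Hr in H by lra.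
assert (E : Rbar_min p_infty p_infty = p_infty).
{ unfold Rbar_min. destruct (Rbar_le_dec p_infty p_infty); auto. }
rewrite E in H.
revert H. generalize (CV_radius (PS_plus (PS_scal b r) (PS_incr_1 (PS_derive r)))).
intros [x| |] H; simpl in H; tauto.
Qed.

Lemma PSeries_shifted_coef (s : R) :
  PSeries (shifted_coef b r) s = b * PSeries r s + s * PSeries (PS_derive r) s.
Proof.
rewrite (PSeries_ext _ _ s shifted_coef_ext), PSeries_plus.
- now rewrite PSeries_scal, PSeries_incr_1.
- apply ex_pseries_scal; [apply Rmult_comm|]. apply CV_radius_inside. now rewrite Hr.
- apply CV_radius_inside. now rewrite CV_radius_incr_1, CV_radius_derive, Hr.
Qed.

Definition shifted_series (s : R) : R := Rpower s b * PSeries r s.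

Definition shifted_series_derive (s : R) : R :=
  Rpower s (b - 1) * PSeries (shifted_coef b r) s.

Lemma is_derive_shifted_series (s : R) : 0 < s ->
  is_derive shifted_series s (shifted_series_derive s).
Proof.
intros Hs. unfold shifted_series_derive. rewrite PSeries_shifted_coef.
replace (Rpower s (b - 1) * (b * PSeries r s + s * PSeries (PS_derive r) s))
  with (plus (mult (b * Rpower s (b - 1)) (PSeries r s)) (mult (Rpower s b) (PSeries (PS_derive r) s))).
- apply (is_derive_mult (K := R_AbsRing) (fun s => Rpower s b) (PSeries r)).
  + now apply is_derive_Rpower.
  + apply is_derive_PSeries. now rewrite Hr.
  + apply Rmult_comm.
- unfold plus, mult; simpl. rewrite (Rpower_S_l s b) by auto. ring.
Qed.

Lemma continuous_shifted_series_derive (s : R) : 0 < s -> continuous shifted_series_derive s.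
Proof.
intros Hs. apply (continuous_mult (K := R_AbsRing)).
- now apply continuous_Rpower.
- apply (ex_derive_continuous (K := R_AbsRing) (V := R_NormedModule)).
  eexists. apply is_derive_PSeries. now rewrite CV_radius_shifted_coef.
Qed.

Lemma Rpower_INR_plus (s x : R) (n : nat) : 0 < s -> Rpower s (INR n + x) = s ^ n * Rpower s x.
Proof. intros Hs. now rewrite Rpower_plus, Rpower_pow. Qed.

Lemma is_RInt_gen_abel_sum (t a : R) (c : nat -> R) (N : nat) : 0 < t -> 0 < a < 1 ->
  is_RInt_gen (fun s => abel_kernel t a s * (Rpower s (b - 1) * sum_n (fun n => c n * s ^ n) N))
    (at_right 0) (at_left t) (sum_n (fun n => c n * abel_moment t a (INR n + b)) N).
Proof.
intros Ht Ha. assert (HD := interval_filters_segment t Ht).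
assert (Hn : forall n, is_RInt_gen (fun s => abel_kernel t a s * (Rpower s (b - 1) * (c n * s ^ n)))
    (at_right 0) (at_left t) (c n * abel_moment t a (INR n + b))).
{ intros n. refine (is_RInt_gen_ext_on HD _ _ _ _
    (seg_int_scal t _ (c n) _ (is_RInt_gen_abel_moment t a Ht Ha (INR n + b) _))).
  - intros x Hx. replace (INR n + b - 1) with (INR n + (b - 1)) by ring.
    rewrite Rpower_INR_plus by lra. ring.
  - generalize (pos_INR n); lra. }
induction N as [|N IH].
- refine (is_RInt_gen_ext_on HD _ _ _ _ (eq_rect _ (fun l => is_RInt_gen _ _ _ l) (Hn 0%nat) _ _)).
  + intros x _. now rewrite sum_O.
  + now rewrite sum_O.
- refine (is_RInt_gen_ext_on HD _ _ _ _ (eq_rect _ (fun l => is_RInt_gen _ _ _ l)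
    (seg_int_plus t _ _ _ _ IH (Hn (S N))) _ _)).
  + intros x _. rewrite sum_Sn. unfold plus; simpl. ring.
  + now rewrite sum_Sn.
Qed.

(** Weierstrass test on (0, t): |c_n s^n| <= |c_n t^n|, a convergent majorant free of s, and s^(b -
    1) <= t^(b - 1) because b >= 1. The partial sums of the derivative therefore converge uniformly
    and may be integrated against the kernel. *)
Lemma is_RInt_gen_shifted_series_derive (t a V : R) : 0 < t -> 0 < a < 1 ->
  is_series (fun n => Lfrac_factor a (INR n + b) * r n * t ^ n) V ->
  is_RInt_gen (fun s => abel_kernel t a s * shifted_series_derive s) (at_right 0) (at_left t)
    (Rpower t (b - a) * (Gamma (1 - a) / Gamma (2 - a)) * V).
Proof.
intros Ht Ha HV. assert (HD := interval_filters_segment t Ht).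
set (c := shifted_coef b r).
set (v := fun n => Rabs (c n * t ^ n)).
assert (Hv : ex_series v).
{ apply CV_disk_inside. unfold c. now rewrite CV_radius_shifted_coef. }
assert (Hcv : forall s, 0 < s < t -> forall n, Rabs (c n * s ^ n) <= v n).
{ intros s Hs n. unfold v. rewrite !Rabs_mult. apply Rmult_le_compat_l; [apply Rabs_pos|].
  rewrite <- !RPow_abs. apply pow_incr. rewrite !Rabs_right by lra. lra. }
assert (Hsp : forall s, 0 < s < t -> 0 <= Rpower s (b - 1) <= Rpower t (b - 1)).
{ intros s Hs; split; [left; apply Rpower_pos|]. apply Rle_Rpower_l; lra. }
apply (is_RInt_gen_uniform_limit HD (abel_kernel t a) shifted_series_derive
  (fun N s => Rpower s (b - 1) * sum_n (fun n => c n * s ^ n) N)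
  (fun N => Rpower t (b - 1) * (Series v - sum_n v N))
  (fun N => sum_n (fun n => c n * abel_moment t a (INR n + b)) N)
  (Rpower t (1 - a) / (1 - a)) _ (Rpower t (b - 1) * Series v)).
- intros x _. left; apply abel_kernel_pos.
- intros x Hx. now apply continuous_abel_kernel.
- intros x Hx. apply continuous_shifted_series_derive; lra.
- intros x Hx. unfold shifted_series_derive. rewrite Rabs_mult.
  apply Rmult_le_compat; try apply Rabs_pos.
  + rewrite Rabs_right; [|left; apply Rpower_pos]. now apply Hsp.
  + apply Rle_trans with (Series (fun n => Rabs (c n * x ^ n))).
    * apply Series_Rabs. apply (CV_disk_inside c). unfold c. now rewrite CV_radius_shifted_coef.
    * apply Series_le; auto. intros n; split; [apply Rabs_pos | now apply Hcv].
- now apply is_RInt_gen_abel_kernel.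
- intros N. now apply is_RInt_gen_abel_sum.
- intros N x Hx. unfold shifted_series_derive. rewrite <- Rmult_minus_distr_l, Rabs_mult.
  apply Rmult_le_compat; try apply Rabs_pos.
  + rewrite Rabs_right; [|left; apply Rpower_pos]. now apply Hsp.
  + apply Series_tail_le; auto.
- replace (Finite 0) with (Finite (Rpower t (b - 1) * (Series v - Series v))) by (f_equal; ring).
  apply is_lim_seq_mult'; [apply is_lim_seq_const|].
  apply is_lim_seq_minus'; [apply is_lim_seq_const|]. now apply Series_correct.
(* Termwise, the factor n + b from differentiation merges with Gamma (n + b) from the Beta integral
   into Gamma (n + b + 1), the numerator of the eigenvalue. *)
- apply (is_lim_seq_ext (fun N => Rpower t (b - a) * (Gamma (1 - a) / Gamma (2 - a)) *
    sum_n (fun n => Lfrac_factor a (INR n + b) * r n * t ^ n) N)).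
  2:{ apply is_lim_seq_mult'; [apply is_lim_seq_const|]. exact HV. }
  intros N.
  rewrite <- (sum_n_mult_l (K := R_AbsRing) (Rpower t (b - a) * (Gamma (1 - a) / Gamma (2 - a)))).
  apply sum_n_ext. intros n. unfold mult; simpl. unfold c, shifted_coef, Lfrac_factor.
  assert (Hn := pos_INR n).
  rewrite abel_moment_eq by (auto; lra).
  replace (INR n + b - a) with (INR n + (b - a)) by ring.
  rewrite Rpower_INR_plus, Gamma_S by lra.
  assert (G1 := Gamma_pos (2 - a) ltac:(lra)).
  assert (G2 := Gamma_pos (INR n + b + 1 - a) ltac:(lra)).
  field. lra.
Qed.

End EntireSeries.

(** * Termwise fractional differentiation *)

(** The real operator solved for its integral: the two normalising constants and the power of t are
    moved to the side of the value [v]. *)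
Definition real_Lfrac (a : R) (f : R -> R) (t v : R) : Prop :=
  exists f' : R -> R, (forall s, 0 < s < t -> is_derive f s (f' s)) /\
    is_RInt_gen (fun s => abel_kernel t a s * f' s) (at_right 0) (at_left t)
      (Rpower t (1 - a) * (Gamma (1 - a) / Gamma (2 - a)) * v).

Lemma is_derive_eq_on (V : NormedModule R_AbsRing) (f g : R -> V) (t s : R) (l : V) :
  (forall x, 0 < x < t -> f x = g x) -> 0 < s < t -> is_derive f s l -> is_derive g s l.
Proof.
intros H Hs. apply is_derive_ext_loc.
assert (Hp : 0 < Rmin s (t - s)) by (apply Rmin_pos; lra).
exists (mkposreal _ Hp). intros y Hy. apply H.
apply ball_Rabs in Hy; simpl in Hy.
apply Rabs_def2 in Hy. generalize (Rmin_l s (t - s)) (Rmin_r s (t - s)). lra.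
Qed.

Lemma Lfrac_factor_pos (a p : R) : 0 < a < 1 -> 0 <= p -> 0 < Lfrac_factor a p.
Proof.
intros Ha Hp. apply Rmult_lt_0_compat; [|apply Rdiv_lt_0_compat]; apply Gamma_pos; lra.
Qed.

(** One denominator for both series: delta = 0 gives [ML_den], and delta = delta_k at index j + 1
    gives the reciprocal of the Gamma quotient in [nu] at index j. *)
Fixpoint Lden (a delta : R) (n : nat) : R :=
  match n with
  | O => 1
  | S m => Lden a delta m * Lfrac_factor a (INR (S m) + delta)
  end.

Lemma Lden_pos (a delta : R) (n : nat) : 0 < a < 1 -> 0 <= delta -> 0 < Lden a delta n.
Proof.
intros Ha Hd. induction n as [|n IH]; [simpl; lra|].
cbn [Lden]. apply Rmult_lt_0_compat; auto. apply Lfrac_factor_pos; auto.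
generalize (pos_INR (S n)); lra.
Qed.

Lemma is_lim_seq_Lfrac_factor (a delta : R) : 0 < a < 1 -> 0 <= delta ->
  is_lim_seq (fun n => Lfrac_factor a (INR (S n) + delta)) p_infty.
Proof.
intros Ha Hd. assert (G := Gamma_pos (2 - a) ltac:(lra)).
apply is_lim_seq_spec. intros M.
(* Chosen so that Gamma (2 - a) * (M' / 2) is [Rmax M 1]; the maximum with 1 keeps M' positive for
   the power 1 / a. Beyond twice that power, (p - a) / 2 raised to a exceeds M'. *)
set (M' := 2 * Rmax M 1 / Gamma (2 - a)).
assert (HM' : 0 < M') by (apply Rdiv_lt_0_compat; auto; generalize (Rmax_r M 1); lra).
assert (HE := Rpower_pos M' (/ a)).
destruct (nfloor_ex (2 * Rpower M' (/ a))) as [N HN]; [lra|].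
exists (S N). intros n Hn.
apply le_INR in Hn. rewrite S_INR in Hn.
set (p := INR (S n) + delta).
assert (Hp : 2 * Rpower M' (/ a) < p - a) by (unfold p; rewrite S_INR; lra).
assert (HL := Gamma_ratio_lower a p ltac:(lra) ltac:(lra)).
assert (HQ : M' < Rpower ((p - a) / 2) a).
{ replace M' with (Rpower (Rpower M' (/ a)) a) at 1.
  - apply Rlt_Rpower_l; lra.
  - rewrite Rpower_mult, Rinv_l, Rpower_1 by lra. auto. }
unfold Lfrac_factor. apply Rle_lt_trans with (Gamma (2 - a) * (M' / 2)).
- unfold M'. apply Rle_trans with (1 := Rmax_l M 1). right. field. lra.
- apply Rmult_lt_compat_l; auto. lra.
Qed.

Lemma CV_radius_inv_Lden (a delta : R) : 0 < a < 1 -> 0 <= delta ->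
  CV_radius (fun n => / Lden a delta n) = p_infty.
Proof.
intros Ha Hd. apply CV_radius_infinite_DAlembert.
- intros n. apply Rinv_neq_0_compat. generalize (Lden_pos a delta n Ha Hd). lra.
- apply (is_lim_seq_ext (fun n => / Lfrac_factor a (INR (S n) + delta))).
  + intros n. assert (P := Lden_pos a delta n Ha Hd).
    assert (Q := Lfrac_factor_pos a (INR (S n) + delta) Ha ltac:(generalize (pos_INR (S n)); lra)).
    cbn [Lden]. replace (_ / _) with (/ Lfrac_factor a (INR (S n) + delta)) by (field; lra).
    rewrite Rabs_right; auto. left. now apply Rinv_0_lt_compat.
  + apply (is_lim_seq_inv _ p_infty); [now apply is_lim_seq_Lfrac_factor | discriminate].
Qed.

(** With a finite radius x, the terms of [r] at x + 1 would not tend to 0; yet they are bounded by C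
    times those of [g] at K (x + 1), which do. *)
Lemma CV_radius_infinite_dominated (g r : nat -> R) (C K : R) :
  CV_radius g = p_infty -> 0 <= K -> (forall n, Rabs (r n) <= C * K ^ n * Rabs (g n)) ->
  CV_radius r = p_infty.
Proof.
intros Hg HK H.
assert (H0 := CV_radius_ge_0 r).
assert (Ho := CV_disk_outside r).
destruct (CV_radius r) as [x| |]; auto; [|contradiction].
simpl in H0. exfalso. apply (Ho (x + 1)).
{ simpl. rewrite Rabs_right; lra. }
assert (Hs : ex_series (fun n => Rabs (g n * (K * (x + 1)) ^ n))).
{ apply CV_disk_inside. now rewrite Hg. }
apply ex_series_lim_0 in Hs.
apply is_lim_seq_abs_0.
apply is_lim_seq_le_le with (fun _ => 0) (fun n => C * Rabs (g n * (K * (x + 1)) ^ n)).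
- intros n. split; [apply Rabs_pos|]. rewrite !Rabs_mult.
  rewrite (Rabs_right ((x + 1) ^ n)) by (apply Rle_ge, pow_le; lra).
  rewrite (Rabs_right ((K * (x + 1)) ^ n)) by (apply Rle_ge, pow_le, Rmult_le_pos; lra).
  rewrite Rpow_mult_distr.
  replace (C * (Rabs (g n) * (K ^ n * (x + 1) ^ n)))
    with (C * K ^ n * Rabs (g n) * (x + 1) ^ n) by ring.
  apply Rmult_le_compat_r; auto. apply pow_le; lra.
- apply is_lim_seq_const.
- replace (Finite 0) with (Finite (C * 0)) by (f_equal; ring).
  apply is_lim_seq_mult'; [apply is_lim_seq_const | exact Hs].
Qed.

(** Term n of [f] is divided by [Lden] at n + 1, whose last factor is exactly the eigenvalue of its
    exponent n + 1 + delta. The operator cancels that factor and lowers the exponent by one, leaving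
    [Lden] at n with t^(n + delta). *)
Lemma real_Lfrac_series (a t delta C K W : R) (m : nat -> R) (f : R -> R) :
  0 < a < 1 -> 0 < t -> 0 <= delta -> 0 <= K -> (forall n, Rabs (m n) <= C * K ^ n) ->
  is_series (fun n => m n * (/ Lden a delta n * Rpower t (INR n + delta))) W ->
  (forall s, 0 < s < t ->
    is_series (fun n => m n * (/ Lden a delta (S n) * Rpower s (INR (S n) + delta))) (f s)) ->
  real_Lfrac a f t W.
Proof.
intros Ha Ht Hd HK Hm HW Hf.
set (r := fun n => m n * / Lden a delta (S n)).
assert (Hr : CV_radius r = p_infty).
{ apply CV_radius_infinite_dominated with (PS_decr_1 (fun n => / Lden a delta n)) C K; auto.
  - rewrite CV_radius_decr_1. now apply CV_radius_inv_Lden.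
  - intros n. unfold r, PS_decr_1. rewrite Rabs_mult.
    apply Rmult_le_compat_r; [apply Rabs_pos | auto]. }
exists (shifted_series_derive (1 + delta) r). split.
- intros s Hs. apply is_derive_eq_on with (f := shifted_series (1 + delta) r) (t := t); auto.
  + intros x Hx. rewrite <- (is_series_unique _ _ (Hf x Hx)).
    unfold shifted_series, PSeries. rewrite <- Series_scal_l. apply Series_ext. intros n.
    unfold r. rewrite S_INR. replace (INR n + 1 + delta) with (INR n + (1 + delta)) by ring.
    rewrite Rpower_INR_plus by lra. ring.
  + apply is_derive_shifted_series; auto; lra.
(* Multiplying by t^(-delta) strips the noninteger power and leaves a power series in t. *)
- assert (HV : is_series (fun n => Lfrac_factor a (INR n + (1 + delta)) * r n * t ^ n)
      (Rpower t (- delta) * W)).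
  { refine (is_series_ext _ _ _ _ (is_series_scal_l (K := R_AbsRing) (Rpower t (- delta)) _ _ HW)).
    intros n. change (Rpower t (- delta) * (m n * (/ Lden a delta n * Rpower t (INR n + delta)))
      = Lfrac_factor a (INR n + (1 + delta)) * r n * t ^ n).
    unfold r. cbn [Lden]. rewrite S_INR.
    replace (INR n + 1 + delta) with (INR n + (1 + delta)) by ring.
    rewrite Rpower_INR_plus by lra.
    assert (P := Lden_pos a delta n Ha Hd).
    assert (Q := Lfrac_factor_pos a (INR n + (1 + delta)) Ha ltac:(generalize (pos_INR n); lra)).
    assert (HH : Rpower t (- delta) * Rpower t delta = 1).
    { rewrite <- Rpower_plus. replace (- delta + delta) with 0 by ring. now apply Rpower_O. }
    transitivity (m n * / Lden a delta n * t ^ n * (Rpower t (- delta) * Rpower t delta)).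
    { ring. }
    rewrite HH.
    field. lra. }
  assert (HI := is_RInt_gen_shifted_series_derive (1 + delta) r ltac:(lra) Hr t a _ Ht Ha HV).
  assert (E : Rpower t (1 + delta - a) * (Gamma (1 - a) / Gamma (2 - a)) * (Rpower t (- delta) * W)
    = Rpower t (1 - a) * (Gamma (1 - a) / Gamma (2 - a)) * W).
  { replace (Rpower t (1 - a)) with (Rpower t (1 + delta - a) * Rpower t (- delta))
      by (rewrite <- Rpower_plus; f_equal; ring).
    ring. }
  rewrite <- E. exact HI.
Qed.

Lemma is_RInt_gen_pair {Fa Fb : (R -> Prop) -> Prop} {PFa : Filter Fa} {PFb : Filter Fb}
  (f g : R -> R) (lf lg : R) :
  is_RInt_gen f Fa Fb lf -> is_RInt_gen g Fa Fb lg ->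
  is_RInt_gen (V := prod_NormedModule R_AbsRing R_NormedModule R_NormedModule)
    (fun s => (f s, g s)) Fa Fb (lf, lg).
Proof.
intros Hf Hg P [eps HP].
assert (H1 := Hf _ (locally_ball lf eps)). assert (H2 := Hg _ (locally_ball lg eps)).
unfold filtermapi in *.
generalize (filter_and (F := filter_prod Fa Fb) _ _ H1 H2).
apply (filter_imp (F := filter_prod Fa Fb)).
intros ab [[y [Hy By]] [z [Hz Bz]]]. exists (y, z). split.
- now apply (is_RInt_fct_extend_pair (fun s => (f s, g s))).
- apply HP. now split.
Qed.

(** Obtained by writing the pair as f (1, 0) + g (0, 1), to which the scalar and sum rules apply. *)
Lemma is_derive_pair (f g : R -> R) (s lf lg : R) :
  is_derive f s lf -> is_derive g s lg ->
  is_derive (V := prod_NormedModule R_AbsRing R_NormedModule R_NormedModule)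
    (fun s => (f s, g s)) s (lf, lg).
Proof.
intros Hf Hg.
pose (V := prod_NormedModule R_AbsRing R_NormedModule R_NormedModule).
assert (H1 := is_derive_scal_l (K := R_AbsRing) (V := V) f s lf (1, 0) Hf).
assert (H2 := is_derive_scal_l (K := R_AbsRing) (V := V) g s lg (0, 1) Hg).
assert (H := is_derive_plus (K := R_AbsRing) (V := V) _ _ _ _ _ H1 H2).
assert (E : forall x y : R, plus (scal x ((1, 0) : V)) (scal y ((0, 1) : V)) = (x, y)).
{ intros x y. apply injective_projections;
  unfold plus, scal; simpl; unfold plus, scal; simpl; unfold mult; simpl; ring. }
rewrite E in H. revert H. apply is_derive_ext. intros; apply E.
Qed.

Lemma is_Lfrac_pair (a t vu vv : R) (u v : R -> R) : 0 < a < 1 -> 0 < t ->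
  real_Lfrac a u t vu -> real_Lfrac a v t vv ->
  is_Lfrac a (fun s => (u s, v s)) t (vu, vv).
Proof.
intros Ha Ht [u' [Du Iu]] [v' [Dv Iv]].
eexists; split.
- exists (fun s => (u' s, v' s)). split.
  + intros s Hs. apply is_derive_pair; auto.
  + eexists; split; [|reflexivity].
    assert (H := is_RInt_gen_pair _ _ _ _ Iu Iv). revert H.
    apply is_RInt_gen_ext. apply filter_forall. intros ab s _.
    apply injective_projections; simpl; unfold abel_kernel; ring.
- assert (G1 := Gamma_pos (1 - a) ltac:(lra)). assert (G2 := Gamma_pos (2 - a) ltac:(lra)).
  assert (P := Rpower_pos t (1 - a)).
  apply injective_projections; simpl; field; lra.
Qed.

Lemma real_Lfrac_const (a t c : R) : 0 < t -> real_Lfrac a (fun _ => c) t 0.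
Proof.
intros Ht. exists (fun _ => 0). split.
- intros s _. apply (is_derive_const (K := R_AbsRing) (V := R_NormedModule)).
- refine (is_RInt_gen_ext_on (interval_filters_segment t Ht) (fun _ => 0) _ _ _ _).
  + intros; ring.
  + replace (Rpower t (1 - a) * (Gamma (1 - a) / Gamma (2 - a)) * 0) with (0 - 0) by ring.
    apply (is_RInt_gen_antiderivative (interval_filters_segment t Ht) (fun _ => 0)).
    * intros; apply (is_derive_const (K := R_AbsRing) (V := R_NormedModule)).
    * intros; apply continuous_const.
    * apply filterlim_const.
    * apply filterlim_const.
Qed.

Lemma is_Lfrac_const (a t : R) (c : C) : 0 < a < 1 -> 0 < t ->
  is_Lfrac a (fun _ => c) t (RtoC 0).
Proof.
intros Ha Ht. destruct c as [x y].
apply (is_Lfrac_pair a t 0 0 (fun _ => x) (fun _ => y)); auto; now apply real_Lfrac_const.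
Qed.

Lemma is_Lfrac_plus (a t : R) (f g : R -> C) (v w : C) :
  is_Lfrac a f t v -> is_Lfrac a g t w ->
  is_Lfrac a (fun s => Cplus (f s) (g s)) t (Cplus v w).
Proof.
intros [c1 [[f' [Df [I1 [H1 ->]]]] ->]] [c2 [[g' [Dg [I2 [H2 ->]]]] ->]].
pose (V := prod_NormedModule R_AbsRing R_NormedModule R_NormedModule).
eexists; split.
- exists (fun s => Cplus (f' s) (g' s)). split.
  + intros s Hs. apply (is_derive_plus (K := R_AbsRing) (V := V)); auto.
  + eexists; split; [|reflexivity].
    assert (H := is_RInt_gen_plus (V := V) _ _ _ _ H1 H2). revert H.
    apply is_RInt_gen_ext. apply filter_forall. intros ab s _.
    symmetry. apply Cmult_plus_distr_l.
- change (plus I1 I2) with (Cplus I1 I2). rewrite !Cmult_plus_distr_l. reflexivity.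
Qed.

(** The operator reads [f] only through its derivative inside (0, t). This permits t = T although
    the solution is prescribed on [0, T] only. *)
Lemma is_Lfrac_ext (a t : R) (f g : R -> C) (v : C) :
  (forall s, 0 < s < t -> f s = g s) -> is_Lfrac a f t v -> is_Lfrac a g t v.
Proof.
intros H [c [[f' [Df HI]] Hv]]. exists c; split; auto. exists f'; split; auto.
intros s Hs. apply is_derive_eq_on with (f := f) (t := t); auto.
Qed.

Lemma is_Lfrac_csum (a t : R) (d : nat) (f : nat -> R -> C) (v : nat -> C) :
  0 < a < 1 -> 0 < t -> (forall k, (k < d)%nat -> is_Lfrac a (f k) t (v k)) ->
  is_Lfrac a (fun s => csum d (fun k => f k s)) t (csum d v).
Proof.
intros Ha Ht. induction d as [|d IH]; intros H.
- exact (is_Lfrac_const a t (RtoC 0) Ha Ht).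
- apply (is_Lfrac_plus a t (fun s => csum d (fun k => f k s)) (f d) (csum d v) (v d)); auto.
Qed.

(** * Complex series and finite sums *)

Lemma fst_sum_n (c : nat -> C) (N : nat) : fst (sum_n c N) = sum_n (fun n => fst (c n)) N.
Proof.
induction N as [|N IH]; [now rewrite !sum_O|]. rewrite !sum_Sn, <- IH. reflexivity.
Qed.

Lemma snd_sum_n (c : nat -> C) (N : nat) : snd (sum_n c N) = sum_n (fun n => snd (c n)) N.
Proof.
induction N as [|N IH]; [now rewrite !sum_O|]. rewrite !sum_Sn, <- IH. reflexivity.
Qed.

Lemma is_series_C_iff (c : nat -> C) (V : C) :
  is_series c V <-> is_series (fun n => fst (c n)) (fst V) /\ is_series (fun n => snd (c n)) (snd V).
Proof.
assert (E := filterlim_locally (F := eventually) (U := C_UniformSpace) (sum_n c) V).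
assert (E1 := filterlim_locally (F := eventually) (U := R_UniformSpace)
  (sum_n (fun n => fst (c n))) (fst V)).
assert (E2 := filterlim_locally (F := eventually) (U := R_UniformSpace)
  (sum_n (fun n => snd (c n))) (snd V)).
split.
- intros H. split; [apply E1 | apply E2]; intros eps; generalize (proj1 E H eps);
    apply filter_imp; intros n [H1 H2].
  + now rewrite <- fst_sum_n.
  + now rewrite <- snd_sum_n.
- intros [H1 H2]. apply E. intros eps.
  generalize (filter_and _ _ (proj1 E1 H1 eps) (proj1 E2 H2 eps)). apply filter_imp.
  intros n [B1 B2]. rewrite <- fst_sum_n in B1. rewrite <- snd_sum_n in B2. now split.
Qed.

Definition CSeries (c : nat -> C) : C := (Series (fun n => fst (c n)), Series (fun n => snd (c n))).

Lemma CSeries_unique (c : nat -> C) (V : C) : is_series c V -> CSeries c = V.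
Proof.
rewrite is_series_C_iff. intros [H1 H2].
apply injective_projections; simpl; now apply is_series_unique.
Qed.

Lemma CSeries_correct (c : nat -> C) (V : C) : is_series c V -> is_series c (CSeries c).
Proof. intros H. now rewrite (CSeries_unique _ _ H). Qed.

Lemma is_series_C_unique (c : nat -> C) (V W : C) : is_series c V -> is_series c W -> V = W.
Proof. intros H1 H2. now rewrite <- (CSeries_unique _ _ H1), <- (CSeries_unique _ _ H2). Qed.

Lemma Rabs_fst_le (z : C) : Rabs (fst z) <= Cmod z.
Proof. apply Rle_trans with (2 := Rmax_Cmod z). apply Rmax_l. Qed.

Lemma Rabs_snd_le (z : C) : Rabs (snd z) <= Cmod z.
Proof. apply Rle_trans with (2 := Rmax_Cmod z). apply Rmax_r. Qed.

Lemma is_series_C_dominated (c : nat -> C) (b : nat -> R) :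
  (forall n, Cmod (c n) <= b n) -> ex_series b -> is_series c (CSeries c).
Proof.
intros H Hb. apply is_series_C_iff. simpl.
split; apply Series_correct;
  apply (ex_series_le (K := R_AbsRing) (V := R_CompleteNormedModule)) with b; auto; intros n.
- exact (Rle_trans _ _ _ (Rabs_fst_le (c n)) (H n)).
- exact (Rle_trans _ _ _ (Rabs_snd_le (c n)) (H n)).
Qed.

(** Geometric growth of [m] amounts to evaluating the entire series at K t instead of t. *)
Lemma is_series_entire (C0 K t : R) (m : nat -> C) (g : nat -> R) :
  CV_radius g = p_infty -> 0 <= K -> (forall n, Cmod (m n) <= C0 * K ^ n) ->
  is_series (fun n => Cmult (m n) (RtoC (g n * t ^ n)))
    (CSeries (fun n => Cmult (m n) (RtoC (g n * t ^ n)))).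
Proof.
intros Hg HK Hm. apply is_series_C_dominated with (fun n => C0 * Rabs (g n * (K * t) ^ n)).
- intros n. rewrite Cmod_mult, Cmod_R, Rpow_mult_distr.
  replace (g n * (K ^ n * t ^ n)) with (K ^ n * (g n * t ^ n)) by ring.
  rewrite (Rabs_mult (K ^ n)), (Rabs_right (K ^ n)) by (apply Rle_ge, pow_le; auto).
  rewrite <- Rmult_assoc. apply Rmult_le_compat_r; [apply Rabs_pos | auto].
- apply (ex_series_scal (K := R_AbsRing) (V := R_NormedModule) C0).
  apply CV_disk_inside. now rewrite Hg.
Qed.

(** The weights multiplying [m] are real, so real and imaginary parts obey the same real statement,
    with coefficients still bounded by C0 K^n. *)
Lemma is_Lfrac_series (a t delta C0 K : R) (m : nat -> C) (f : R -> C) (W : C) :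
  0 < a < 1 -> 0 < t -> 0 <= delta -> 0 <= K -> (forall n, Cmod (m n) <= C0 * K ^ n) ->
  is_series (fun n => Cmult (m n) (RtoC (/ Lden a delta n * Rpower t (INR n + delta)))) W ->
  (forall s, 0 < s < t ->
    is_series (fun n => Cmult (m n) (RtoC (/ Lden a delta (S n) * Rpower s (INR (S n) + delta)))) (f s)) ->
  is_Lfrac a f t W.
Proof.
intros Ha Ht Hd HK Hm HW Hf.
apply is_Lfrac_ext with (fun s => (fst (f s), snd (f s))).
{ intros s _. now destruct (f s). }
rewrite (surjective_pairing W). apply is_series_C_iff in HW as [HW1 HW2].
apply is_Lfrac_pair; auto.
- apply real_Lfrac_series with delta C0 K (fun n => fst (m n)); auto.
  + intros n. exact (Rle_trans _ _ _ (Rabs_fst_le (m n)) (Hm n)).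
  + revert HW1. apply is_series_ext. intros n. simpl. ring.
  + intros s Hs. destruct (proj1 (is_series_C_iff _ _) (Hf s Hs)) as [H _].
    revert H. apply is_series_ext. intros n. simpl. ring.
- apply real_Lfrac_series with delta C0 K (fun n => snd (m n)); auto.
  + intros n. exact (Rle_trans _ _ _ (Rabs_snd_le (m n)) (Hm n)).
  + revert HW2. apply is_series_ext. intros n. simpl. ring.
  + intros s Hs. destruct (proj1 (is_series_C_iff _ _) (Hf s Hs)) as [_ H].
    revert H. apply is_series_ext. intros n. simpl. ring.
Qed.

Lemma csum_ext (d : nat) (f g : nat -> C) :
  (forall k, (k < d)%nat -> f k = g k) -> csum d f = csum d g.
Proof.
induction d as [|d IH]; intros H; auto. cbn [csum]. rewrite IH, H by auto. reflexivity.
Qed.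

Lemma csum_plus (d : nat) (f g : nat -> C) :
  csum d (fun k => Cplus (f k) (g k)) = Cplus (csum d f) (csum d g).
Proof. induction d as [|d IH]; cbn [csum]; [|rewrite IH]; ring. Qed.

Lemma csum_mult_l (d : nat) (c : C) (f : nat -> C) :
  csum d (fun k => Cmult c (f k)) = Cmult c (csum d f).
Proof. induction d as [|d IH]; cbn [csum]; [|rewrite IH]; ring. Qed.

Lemma csum_mult_r (d : nat) (c : C) (f : nat -> C) :
  csum d (fun k => Cmult (f k) c) = Cmult (csum d f) c.
Proof. induction d as [|d IH]; cbn [csum]; [|rewrite IH]; ring. Qed.

Lemma csum_0 (d : nat) : csum d (fun _ => RtoC 0) = RtoC 0.
Proof. induction d as [|d IH]; cbn [csum]; [|rewrite IH]; ring. Qed.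

Lemma csum_exchange (d e : nat) (f : nat -> nat -> C) :
  csum d (fun i => csum e (fun j => f i j)) = csum e (fun j => csum d (fun i => f i j)).
Proof.
induction d as [|d IH]; cbn [csum]; [now rewrite csum_0|]. now rewrite IH, csum_plus.
Qed.

Lemma csum_matid (d k : nat) (v : nat -> C) : (k < d)%nat ->
  csum d (fun l => Cmult (matid k l) (v l)) = v k.
Proof.
unfold matid. intros Hk. induction d as [|d IH]; [lia|]. cbn [csum].
destruct (Nat.eq_dec k d) as [->|H].
- rewrite Nat.eqb_refl, (csum_ext _ _ (fun _ => RtoC 0)), csum_0; [ring|].
  intros l Hl. destruct (Nat.eqb_spec d l); [lia | ring].
- rewrite IH by lia. destruct (Nat.eqb_spec k d); [lia | ring].
Qed.

Lemma Cmod_csum_le (d : nat) (f : nat -> C) (B : R) :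
  (forall k, (k < d)%nat -> Cmod (f k) <= B) -> Cmod (csum d f) <= INR d * B.
Proof.
induction d as [|d IH]; intros H.
- cbn [csum]. rewrite Cmod_0. simpl. lra.
- cbn [csum]. rewrite S_INR. apply Rle_trans with (1 := Cmod_triangle _ _).
  specialize (H d ltac:(lia)) as Hd. specialize (IH ltac:(auto)). lra.
Qed.

Lemma is_series_csum (d : nat) (c : nat -> nat -> C) (V : nat -> C) :
  (forall k, (k < d)%nat -> is_series (c k) (V k)) ->
  is_series (fun n => csum d (fun k => c k n)) (csum d V).
Proof.
induction d as [|d IH]; intros H.
- apply is_series_C_iff. cbn [csum]. simpl.
  split; apply is_series_Reals; intros eps He; exists 0%nat; intros n _;
    rewrite sum_eq_R0 by auto; rewrite R_dist_eq; auto.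
- exact (is_series_plus (K := C_AbsRing) (V := C_NormedModule)
    _ _ _ _ (IH ltac:(auto)) (H d ltac:(lia))).
Qed.

Lemma is_series_Cmult_l (z : C) (c : nat -> C) (V : C) :
  is_series c V -> is_series (fun n => Cmult z (c n)) (Cmult z V).
Proof. apply (is_series_scal (K := C_AbsRing) (V := C_NormedModule)). Qed.

Lemma is_series_C_tail (c : nat -> C) (V : C) :
  is_series c V -> is_series (fun n => c (S n)) (Cminus V (c 0%nat)).
Proof.
intros H. apply (is_series_incr_1 (K := C_AbsRing) (V := C_NormedModule)).
change (is_series c (Cplus (Cminus V (c 0%nat)) (c 0%nat))).
replace (Cplus (Cminus V (c 0%nat)) (c 0%nat)) with V by ring. exact H.
Qed.

Lemma is_series_C_cons (c : nat -> C) (V : C) :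
  is_series (fun n => c (S n)) V -> is_series c (Cplus (c 0%nat) V).
Proof.
intros H. apply (is_series_decr_1 (K := C_AbsRing) (V := C_NormedModule)).
change (is_series (fun n => c (S n)) (Cplus (Cplus (c 0%nat) V) (Copp (c 0%nat)))).
replace (Cplus (Cplus (c 0%nat) V) (Copp (c 0%nat))) with V by ring. exact H.
Qed.

Lemma finite_bound (d : nat) (f : nat -> R) :
  exists B, 0 <= B /\ forall k, (k < d)%nat -> f k <= B.
Proof.
induction d as [|d [B [HB H]]].
- exists 0. split; [lra | intros; lia].
- exists (Rmax B (f d)). split; [apply Rle_trans with (1 := HB), Rmax_l|].
  intros k Hk. destruct (Nat.eq_dec k d) as [->|Hkd]; [apply Rmax_r|].
  apply Rle_trans with (2 := Rmax_l _ _). apply H; lia.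
Qed.

Lemma matpow_bound (d : nat) (A : mat) : exists K, 0 <= K /\
  forall n i j, (i < d)%nat -> (j < d)%nat -> Cmod (matpow d A n i j) <= K ^ n.
Proof.
(* The entry (i, j) is encoded by the single index d * i + j. The base K is then d times the largest
   entry, the factor d counting the terms of each product entry. *)
destruct (finite_bound (d * d) (fun p => Cmod (A (p / d)%nat (p mod d)%nat))) as [B [HB HA]].
exists (INR d * B). split; [apply Rmult_le_pos; auto; apply pos_INR|].
assert (HA' : forall i j, (i < d)%nat -> (j < d)%nat -> Cmod (A i j) <= B).
{ intros i j Hi Hj. specialize (HA (d * i + j)%nat ltac:(nia)).
  rewrite <- (Nat.div_unique (d * i + j) d i j), <- (Nat.mod_unique (d * i + j) d i j) in HA; auto. }
induction n as [|n IH]; intros i j Hi Hj.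
- simpl. unfold matid. destruct (Nat.eqb i j); [rewrite Cmod_1 | rewrite Cmod_0]; lra.
- cbn [matpow pow]. unfold matmul. rewrite Rmult_assoc. apply Cmod_csum_le. intros l Hl.
  rewrite Cmod_mult. apply Rmult_le_compat; auto using Cmod_ge_0.
Qed.

Lemma matpow_matscale (d : nat) (A : mat) (t : R) (n i j : nat) :
  matpow d (matscale (RtoC t) A) n i j = Cmult (RtoC (t ^ n)) (matpow d A n i j).
Proof.
revert i j. induction n as [|n IH]; intros i j.
- simpl. ring.
- cbn [matpow pow]. unfold matmul. rewrite <- csum_mult_l. apply csum_ext. intros l _.
  unfold matscale. rewrite IH, RtoC_mult. ring.
Qed.

Lemma ML_den_Lden (a : R) (n : nat) : ML_den a n = Lden a 0 n.
Proof.
induction n as [|n IH]; auto. cbn [ML_den Lden]. rewrite IH, Rplus_0_r. reflexivity.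
Qed.

(** Factor i of the quotient is 1 / lambda_p with p = i + 1 + delta: the arguments i + 2 + delta and
    i + 2 - a + delta are p + 1 and p + 1 - a. *)
Lemma nu_coef_Lden (a delta : R) (n : nat) : 0 < a < 1 -> 0 <= delta ->
  prodR n (fun i => Gamma (INR (i + 2) - a + delta))
    / (Gamma (2 - a) ^ n * prodR n (fun i => Gamma (INR (i + 2) + delta))) = / Lden a delta n.
Proof.
intros Ha Hd.
assert (G : 0 < Gamma (2 - a)) by (apply Gamma_pos; lra).
assert (G2 : forall i, 0 < Gamma (INR (i + 2) + delta)).
{ intros i. apply Gamma_pos. rewrite plus_INR. simpl. generalize (pos_INR i); lra. }
assert (P : forall n, 0 < prodR n (fun i => Gamma (INR (i + 2) + delta))).
{ clear n. induction n as [|n IH]; simpl; [lra | now apply Rmult_lt_0_compat]. }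
induction n as [|n IH]; [simpl; field|].
assert (L := Lden_pos a delta n Ha Hd).
assert (G1 : 0 < Gamma (INR (n + 2) - a + delta)).
{ apply Gamma_pos. rewrite plus_INR. simpl. generalize (pos_INR n); lra. }
cbn [prodR Lden pow].
assert (EL : Lfrac_factor a (INR (S n) + delta)
  = Gamma (2 - a) * (Gamma (INR (n + 2) + delta) / Gamma (INR (n + 2) - a + delta))).
{ unfold Lfrac_factor. rewrite S_INR, plus_INR. simpl (INR 2).
  replace (INR n + (1 + 1) - a + delta) with (INR n + 1 + delta + 1 - a) by ring.
  replace (INR n + (1 + 1) + delta) with (INR n + 1 + delta + 1) by ring. reflexivity. }
rewrite EL, Rinv_mult, <- IH. specialize (G2 n). specialize (P n).
assert (Gn : 0 < Gamma (2 - a) ^ n) by (apply pow_lt; auto).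
field. lra.
Qed.

(** * The solution *)

Definition ML_entry (a : R) (d : nat) (A : mat) (t : R) (i j : nat) : C :=
  CSeries (fun n => Cmult (matpow d A n i j) (RtoC (/ Lden a 0 n * t ^ n))).

(** The contribution of component k of the forcing to row i of the sum of the A^n nu_n. Fixing k
    fixes the exponent delta_k, so each entry is one power of t times an entire series. *)
Definition nu_entry (a : R) (d : nat) (A : mat) (l : nat -> C) (delta : nat -> R)
    (t : R) (i k : nat) : C :=
  CSeries (fun n => Cmult (matpow d A n i k) (nu a l delta n t k)).

Lemma nu_pos (a : R) (l : nat -> C) (delta : nat -> R) (n : nat) (t : R) (k : nat) :
  0 < a < 1 -> 0 < delta k -> 0 < t ->
  nu a l delta n t k
    = Cmult (l k) (RtoC (/ Lden a (delta k) (S n) * Rpower t (INR (S n) + delta k))).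
Proof.
intros Ha Hd Ht. unfold nu. rewrite nu_coef_Lden by lra.
unfold powr. destruct (Rle_dec t 0); [lra|]. reflexivity.
Qed.

Lemma nu_0 (a : R) (l : nat -> C) (delta : nat -> R) (n k : nat) : nu a l delta n 0 k = RtoC 0.
Proof.
unfold nu, powr. destruct (Rle_dec 0 0); [|lra]. rewrite Rmult_0_r. ring.
Qed.

Lemma is_series_C_ext (u v : nat -> C) (V : C) :
  (forall n, u n = v n) -> is_series u V -> is_series v V.
Proof. apply (is_series_ext (K := C_AbsRing) (V := C_NormedModule)). Qed.

Lemma is_series_C_0 (c : nat -> C) : (forall n, c n = RtoC 0) -> is_series c (RtoC 0).
Proof.
intros H. refine (is_series_C_ext _ _ _ _ (is_series_csum 0 (fun _ _ => RtoC 0) (fun _ => RtoC 0) _)).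
- intros n. now rewrite H.
- intros; lia.
Qed.

Section Solution.

Context (d : nat) (a : R) (A : mat) (l : nat -> C) (delta : nat -> R)
  (Ha : 0 < a < 1) (Hdelta : forall k, (k < d)%nat -> 0 < delta k).

Lemma ML_entry_series (t : R) (i j : nat) : (i < d)%nat -> (j < d)%nat ->
  is_series (fun n => Cmult (matpow d A n i j) (RtoC (/ Lden a 0 n * t ^ n)))
    (ML_entry a d A t i j).
Proof.
intros Hi Hj. destruct (matpow_bound d A) as [K [HK HB]].
apply is_series_entire with (C0 := 1) (K := K) (g := fun n => / Lden a 0 n); auto.
- apply CV_radius_inv_Lden; auto; lra.
- intros n. rewrite Rmult_1_l. now apply HB.
Qed.

Lemma ML_entry_is_MittagLeffler (t : R) :
  is_MittagLeffler a d (matscale (RtoC t) A) (ML_entry a d A t).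
Proof.
intros i j Hi Hj. assert (H := ML_entry_series t i j Hi Hj). revert H.
apply is_series_C_ext. intros n. rewrite matpow_matscale, ML_den_Lden, RtoC_mult. ring.
Qed.

Lemma nu_entry_series (t : R) (i k : nat) : 0 <= t -> (i < d)%nat -> (k < d)%nat ->
  is_series (fun n => Cmult (matpow d A n i k) (nu a l delta n t k))
    (nu_entry a d A l delta t i k).
Proof.
intros [Ht|<-] Hi Hk; unfold nu_entry.
- destruct (matpow_bound d A) as [K [HK HB]]. assert (Hd := Hdelta k Hk).
  (* The common factor t^(1 + delta_k) is absorbed into the coefficients, and an entire series in t
     remains. *)
  assert (H := is_series_entire (Cmod (l k) * Rpower t (1 + delta k)) K t
    (fun n => Cmult (matpow d A n i k) (Cmult (l k) (RtoC (Rpower t (1 + delta k)))))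
    (PS_decr_1 (fun n => / Lden a (delta k) n))).
  eapply CSeries_correct. eapply is_series_C_ext; [|apply H; auto].
  + intros n. cbn beta. rewrite nu_pos by auto. unfold PS_decr_1.
    rewrite S_INR, Rplus_assoc, Rpower_INR_plus, !RtoC_mult by auto. ring.
  + rewrite CV_radius_decr_1. apply CV_radius_inv_Lden; auto; lra.
  + intros n. rewrite !Cmod_mult, Cmod_R.
    rewrite Rabs_right by (left; apply Rpower_pos).
    rewrite Rmult_comm. apply Rmult_le_compat_l; auto.
    apply Rmult_le_pos; [apply Cmod_ge_0 | left; apply Rpower_pos].
- apply CSeries_correct with (RtoC 0). apply is_series_C_0. intros n. rewrite nu_0. ring.
Qed.

(** The constant term is set apart because its image is 0 and it does not follow the shift rule; all
    remaining exponents are at least 1. *)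
Lemma ML_entry_tail (t : R) (i j : nat) : (i < d)%nat -> (j < d)%nat ->
  is_series (fun n => Cmult (matpow d A (S n) i j) (RtoC (/ Lden a 0 (S n) * t ^ S n)))
    (Cminus (ML_entry a d A t i j) (matid i j)).
Proof.
intros Hi Hj. assert (H := is_series_C_tail _ _ (ML_entry_series t i j Hi Hj)).
cbv beta in H. replace (matid i j) with (Cmult (matpow d A 0 i j) (RtoC (/ Lden a 0 0 * t ^ 0))).
- exact H.
- simpl. rewrite Rinv_1, Rmult_1_l. ring.
Qed.

Lemma ML_entry_0 (i j : nat) : (i < d)%nat -> (j < d)%nat -> ML_entry a d A 0 i j = matid i j.
Proof.
intros Hi Hj. assert (H := ML_entry_tail 0 i j Hi Hj).
assert (E : Cminus (ML_entry a d A 0 i j) (matid i j) = RtoC 0).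
{ apply (is_series_C_unique _ _ _ H). apply is_series_C_0. intros n.
  simpl. rewrite Rmult_0_l, Rmult_0_r. ring. }
replace (ML_entry a d A 0 i j) with (Cplus (Cminus (ML_entry a d A 0 i j) (matid i j)) (matid i j))
  by ring.
rewrite E. ring.
Qed.

Lemma nu_entry_0 (i k : nat) : (i < d)%nat -> (k < d)%nat -> nu_entry a d A l delta 0 i k = RtoC 0.
Proof.
intros Hi Hk. apply (is_series_C_unique _ _ _ (nu_entry_series 0 i k (Rle_refl 0) Hi Hk)).
apply is_series_C_0. intros n. rewrite nu_0. ring.
Qed.

(** The shift rule with delta = 0 and coefficients taken from A^(n + 1): lowering the denominator
    and the exponent leaves A^(n + 1) against t^n, that is A times the Mittag-Leffler series. The
    extra power of A is the factor K in the bound. *)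
Lemma is_Lfrac_ML_entry (t : R) (i j : nat) (z : C) : 0 < t -> (i < d)%nat -> (j < d)%nat ->
  is_Lfrac a (fun s => Cmult (Cminus (ML_entry a d A s i j) (matid i j)) z) t
    (Cmult (csum d (fun p => Cmult (A i p) (ML_entry a d A t p j))) z).
Proof.
intros Ht Hi Hj. destruct (matpow_bound d A) as [K [HK HB]].
apply is_Lfrac_series with 0 (K * Cmod z) K (fun n => Cmult (matpow d A (S n) i j) z); auto; try lra.
- intros n. rewrite Cmod_mult. specialize (HB (S n) i j Hi Hj). cbn [pow] in HB.
  apply Rmult_le_compat_r with (r := Cmod z) in HB; [|apply Cmod_ge_0]. lra.
- rewrite Cmult_comm. eapply is_series_C_ext.
  2:{ apply is_series_Cmult_l. apply is_series_csum. intros p Hp.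
      apply is_series_Cmult_l. exact (ML_entry_series t p j Hp Hj). }
  intros n. cbn beta. cbn [matpow]. unfold matmul.
  rewrite Rplus_0_r, Rpower_pow by auto.
  rewrite (csum_ext d _ (fun p => Cmult (Cmult (A i p) (matpow d A n p j)) (RtoC (/ Lden a 0 n * t ^ n))))
    by (intros; ring).
  rewrite csum_mult_r. ring.
- intros s Hs. rewrite Cmult_comm. eapply is_series_C_ext.
  2:{ apply is_series_Cmult_l. exact (ML_entry_tail s i j Hi Hj). }
  intros n. cbn beta. rewrite Rplus_0_r, Rpower_pow by lra. ring.
Qed.

(** Here the coefficients come from A^n, without shift. The image of the term n = 0 is the forcing
    l_k t^(delta_k), present in row k only, and the terms from n = 1 on recombine into A times the
    original series. *)
Lemma is_Lfrac_nu_entry (t : R) (i k : nat) : 0 < t -> (i < d)%nat -> (k < d)%nat ->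
  is_Lfrac a (fun s => nu_entry a d A l delta s i k) t
    (Cplus (Cmult (matid i k) (Cmult (l k) (RtoC (powr t (delta k)))))
      (csum d (fun p => Cmult (A i p) (nu_entry a d A l delta t p k)))).
Proof.
intros Ht Hi Hk. destruct (matpow_bound d A) as [K [HK HB]]. assert (Hd := Hdelta k Hk).
apply is_Lfrac_series with (delta k) (Cmod (l k)) K (fun n => Cmult (matpow d A n i k) (l k));
  auto; try lra.
- intros n. rewrite Cmod_mult, Rmult_comm. apply Rmult_le_compat_l; auto using Cmod_ge_0.
- replace (Cmult (matid i k) (Cmult (l k) (RtoC (powr t (delta k)))))
    with (Cmult (Cmult (matpow d A 0 i k) (l k))
      (RtoC (/ Lden a (delta k) 0 * Rpower t (INR 0 + delta k)))).
  2:{ simpl. rewrite Rplus_0_l, Rinv_1, Rmult_1_l. unfold powr.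
      destruct (Rle_dec t 0); [lra | ring]. }
  apply (is_series_C_cons (fun n => Cmult (Cmult (matpow d A n i k) (l k))
    (RtoC (/ Lden a (delta k) n * Rpower t (INR n + delta k))))).
  eapply is_series_C_ext.
  2:{ apply is_series_csum. intros p Hp.
      apply is_series_Cmult_l. exact (nu_entry_series t p k (Rlt_le _ _ Ht) Hp Hk). }
  intros n. cbn beta. cbn [matpow]. unfold matmul. rewrite nu_pos by auto.
  rewrite (csum_ext d _ (fun p => Cmult (Cmult (A i p) (matpow d A n p k))
    (Cmult (l k) (RtoC (/ Lden a (delta k) (S n) * Rpower t (INR (S n) + delta k))))))
    by (intros; ring).
  rewrite csum_mult_r. ring.
- intros s Hs. eapply is_series_C_ext.
  2:{ exact (nu_entry_series s i k ltac:(lra) Hi Hk). }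
  intros n. cbn beta. rewrite nu_pos by (auto; lra). ring.
Qed.

End Solution.

Theorem mainTheorem13 (d : nat) (a T : R) (A : mat) (x0 : vec)
  (l : nat -> C) (delta : nat -> R) :
  0 < a < 1 -> 0 < T -> (forall k, (k < d)%nat -> 0 < delta k) ->
  let theta : R -> vec := fun t k => Cmult (l k) (RtoC (powr t (delta k))) in
  (* the series defining x(t) converge for every t in [0,T] *)
  (forall t, 0 <= t <= T ->
     (exists E, is_MittagLeffler a d (matscale (RtoC t) A) E) /\
     (forall k, (k < d)%nat ->
        ex_series (fun j => matvec d (matpow d A j) (nu a l delta j t) k))) /\
  (* and the resulting x solves the problem *)
  (forall x : R -> vec,
     (forall t, 0 <= t <= T ->
        exists E, is_MittagLeffler a d (matscale (RtoC t) A) E /\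
          forall k, (k < d)%nat ->
            exists S, is_series (fun j => matvec d (matpow d A j) (nu a l delta j t) k) S /\
              x t k = Cplus (matvec d E x0 k) S) ->
     (forall k, (k < d)%nat -> x 0 k = x0 k) /\
     (forall t, 0 < t <= T -> forall k, (k < d)%nat ->
        is_Lfrac a (fun s => x s k) t (Cplus (matvec d A (x t) k) (theta t k)))).
Proof.
intros Ha HT Hdelta theta.
(* The matrix-vector product is a finite sum over columns, so the vector series is the sum of the
   scalar series, each with its own exponent. *)
assert (HN : forall t k, 0 <= t -> (k < d)%nat ->
  is_series (fun j => matvec d (matpow d A j) (nu a l delta j t) k)
    (csum d (fun i => nu_entry a d A l delta t k i))).
{ intros t k Ht Hk.
  apply (is_series_csum d (fun i j => Cmult (matpow d A j k i) (nu a l delta j t i))).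
  intros i Hi. now apply nu_entry_series. }
split.
{ intros t Ht. split.
  - eexists. now apply ML_entry_is_MittagLeffler.
  - intros k Hk. eexists. apply HN; tauto. }
intros x Hx.
(* Uniqueness of sums identifies the sums chosen in the hypothesis with the explicit entries. *)
assert (Ex : forall t k, 0 <= t <= T -> (k < d)%nat ->
  x t k = Cplus (csum d (fun j => Cmult (ML_entry a d A t k j) (x0 j)))
    (csum d (fun i => nu_entry a d A l delta t k i))).
{ intros t k Ht Hk. destruct (Hx t Ht) as [E [HE HS]].
  destruct (HS k Hk) as [S [HS1 ->]].
  rewrite (is_series_C_unique _ _ _ HS1 (HN t k (proj1 Ht) Hk)). f_equal.
  apply csum_ext. intros j Hj. f_equal.
  exact (is_series_C_unique _ _ _ (HE k j Hk Hj)
    (ML_entry_is_MittagLeffler d a A Ha t k j Hk Hj)). }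
split.
{ intros k Hk. rewrite Ex by (auto; lra).
  rewrite (csum_ext d (fun i => nu_entry a d A l delta 0 k i) (fun _ => RtoC 0))
    by (intros; now apply nu_entry_0).
  rewrite (csum_ext d _ (fun j => Cmult (matid k j) (x0 j)))
    by (intros; now rewrite ML_entry_0).
  rewrite csum_0, csum_matid by auto. ring. }
intros t Ht k Hk.
(* The initial value is separated by writing x0 as the identity matrix applied to x0, so that each
   Mittag-Leffler entry appears with its constant term removed. *)
apply is_Lfrac_ext with (fun s => Cplus (x0 k)
  (csum d (fun j => Cplus (Cmult (Cminus (ML_entry a d A s k j) (matid k j)) (x0 j))
    (nu_entry a d A l delta s k j)))).
{ intros s Hs. rewrite Ex by (auto; lra). rewrite csum_plus.
  rewrite <- (csum_matid d k x0) by auto. rewrite Cplus_assoc, <- csum_plus.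
  f_equal. apply csum_ext. intros; ring. }
replace (Cplus (matvec d A (x t) k) (theta t k)) with (Cplus (RtoC 0) (csum d (fun j => Cplus
  (Cmult (csum d (fun p => Cmult (A k p) (ML_entry a d A t p j))) (x0 j))
  (Cplus (Cmult (matid k j) (Cmult (l j) (RtoC (powr t (delta j)))))
      (csum d (fun p => Cmult (A k p) (nu_entry a d A l delta t p j))))))).
- apply is_Lfrac_plus; [apply is_Lfrac_const; lra|].
  apply is_Lfrac_csum; [auto | lra |]. intros j Hj.
  apply is_Lfrac_plus; [apply is_Lfrac_ML_entry | apply is_Lfrac_nu_entry]; auto; lra.
- rewrite !csum_plus, (csum_matid d k (fun j => Cmult (l j) (RtoC (powr t (delta j))))) by auto.
  unfold matvec, theta.
  (* The operator was applied column by column, with A inside the sum over columns; expanding A x(t)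
     and exchanging the two finite sums gives the same expression. *)
  rewrite (csum_ext d (fun p => Cmult (A k p) (x t p)) (fun p => Cplus
    (csum d (fun j => Cmult (Cmult (A k p) (ML_entry a d A t p j)) (x0 j)))
    (csum d (fun j => Cmult (A k p) (nu_entry a d A l delta t p j))))).
  + rewrite csum_plus,
      (csum_exchange d d (fun p j => Cmult (Cmult (A k p) (ML_entry a d A t p j)) (x0 j))),
      (csum_exchange d d (fun p j => Cmult (A k p) (nu_entry a d A l delta t p j))).
    rewrite (csum_ext d (fun j => csum d (fun p => Cmult (Cmult (A k p) (ML_entry a d A t p j)) (x0 j)))
      _ (fun j _ => csum_mult_r d (x0 j) (fun p => Cmult (A k p) (ML_entry a d A t p j)))).
    ring.
  + intros p Hp. rewrite Ex by (auto; lra). rewrite csum_mult_l.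
    rewrite Cmult_plus_distr_l, <- csum_mult_l. f_equal. apply csum_ext. intros; ring.
Qed.
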